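(* There exist absolute constants $c>0$ and $C_0>0$ such that the following holds for all sufficiently large $n$. Let $\xi$ be an integer-valued random variable (not necessarily bounded, possibly depending on $n$) which is $\alpha_n$-balanced with $\alpha_n\ge\frac{C_0\log n}{n}$, and let $M_{n\times n}$ be the $n\times n$ random matrix whose entries are i.i.d. copies of $\xi$. Then the probability $p_n$ that $M_{n\times n}$ is singular satisfies $$p_n\le e^{-c\alpha_n n}.$$
   Context: For $0<\alpha_n<1$, an integer-valued random variable $\xi$ is $\alpha_n$-balanced if for every prime $p$, $\max_{x\in\mathbf{Z}/p\mathbf{Z}}\mathbf{P}(\xi\equiv x \bmod p)\le 1-\alpha_n$; the parameter $\alpha_n$ may depend on $n$. Singular means $\det(M_{n\times n})=0$ over the integers (equivalently over $\mathbf{Q}$). *)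

(* Defs.v *)
From HB Require Import structures.
From mathcomp Require Import all_boot all_order all_algebra.
From mathcomp Require Import all_classical all_reals all_analysis.
Set Implicit Arguments.
Unset Strict Implicit.
Unset Printing Implicit Defensive.
Import Order.TTheory GRing.Theory Num.Theory.
Import numFieldNormedType.Exports.
Local Open Scope classical_set_scope.
Local Open Scope ring_scope.

(* [int] carries the discrete sigma-algebra (every subset is measurable), as
   [nat] and [bool] do in MathComp-Analysis, so that an integer-valued random
   variable is an element of [{RV P >-> int}]. *)
HB.instance Definition _ := isPointed.Build int 0.
HB.instance Definition _ := @isMeasurable.Build default_measure_display
  int discrete_measurable discrete_measurable0
  discrete_measurableC discrete_measurableU.

(* For prime [p], ['F_p] is Z/pZ and [(xi w)%:~R] is the residue class of
   [xi w]. The default value [-oo] of the maximum plays no role, since ['F_p]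
   is inhabited. *)
Definition balanced {R : realType} {d : measure_display} {T : measurableType d}
    (P : probability T R) (alpha : R) (xi : {RV P >-> int}) : Prop :=
  0 < alpha < 1 /\
  forall p : nat, prime p ->
    (\big[maxe/-oo]_(x : 'F_p) P [set w | (xi w)%:~R = x]
       <= (1 - alpha)%:E)%E.

(* The two variables may live on different probability spaces. *)
Definition identically_distributed {R : realType}
    {d1 d2 d' : measure_display} {T1 : measurableType d1}
    {T2 : measurableType d2} {T' : measurableType d'}
    (P1 : probability T1 R) (P2 : probability T2 R)
    (X : {RV P1 >-> T'}) (Y : {RV P2 >-> T'}) : Prop :=
  forall A : set T', measurable A -> distribution P1 X A = distribution P2 Y A.

Definition mutually_independent {R : realType} {d d' : measure_display}
    {T : measurableType d} {T' : measurableType d'} (P : probability T R)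
    {I : finType} (X : I -> {RV P >-> T'}) : Prop :=
  forall (J : {set I}) (A : I -> set T'),
    (forall i, i \in J -> measurable (A i)) ->
    P (\bigcap_(i in [set` J]) X i @^-1` A i) =
    (\prod_(i in J) P (X i @^-1` A i))%E.

Definition iid_copies {R : realType} {d0 d d' : measure_display}
    {T0 : measurableType d0} {T : measurableType d} {T' : measurableType d'}
    (P0 : probability T0 R) (P : probability T R)
    (xi : {RV P0 >-> T'}) {I : finType} (X : I -> {RV P >-> T'}) : Prop :=
  (forall i, identically_distributed (X i) xi) /\ mutually_independent X.

Definition random_matrix {R : realType} {d : measure_display}
    {T : measurableType d} (P : probability T R) {n : nat}
    (X : 'I_n * 'I_n -> {RV P >-> int}) (w : T) : 'M[int]_n :=
  \matrix_(i < n, j < n) X (i, j) w.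

(* Main.v *)
Require Import Defs.
From HB Require Import structures.
From mathcomp Require Import all_boot all_order all_algebra.
From mathcomp Require Import ring lra zify complex.
From mathcomp Require Import all_classical all_reals all_analysis.
From mathcomp Require Import fintype finset.
Set Implicit Arguments.
Unset Strict Implicit.
Unset Printing Implicit Defensive.
Import Order.TTheory GRing.Theory Num.Theory ComplexField.Normc.
Import numFieldNormedType.Exports.
Local Open Scope ring_scope.

(** A matrix that is singular over the integers is singular modulo every prime,
    so it is enough to bound the probability of singularity modulo a single
    prime [p >= e^n]. Modulo [p] the entries follow a probability vector [q] on
    ['F_p] whose atoms are at most [1 - alpha], and every probability becomes a
    finite weighted sum. Put [al = alpha / 2], so that [al <= 1 / 2], and let
    [W] be the row space of the random matrix, so that its kernel is the
    orthogonal [W^perp]. A singular matrix falls under one of three cases.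

    - Some nonzero [v] in the kernel has small support, of size [k] say
      ([Pr_sparse_kernel], [sparse_sum]). Fewer than [k] rows already span all
      the rows restricted to the support of [v]; these rows alone determine a
      vector [u] with the same support to which all other rows have to be
      orthogonal. A linear form with [k] nonzero coefficients takes a given
      value with probability at most [(1 + (1 - 2 al)^k) / 2], so each choice of
      support and rows has probability at most [exp (- c n min (1, al k))]. As
      long as [al k <= 1] there are at most [n^(2k)] choices, which
      [al >= C log n / n] absorbs; for larger [k] the number of choices is a
      small exponential in [n], because [k] is a small fraction of [n].

    - The probability that a new row falls into [W] is at most [exp (- T)], with
      [T] a small multiple of [al n] ([Pr_light_span]). One of the rows lies in
      the span of the others, of which it is independent; a union bound over
      this row gives [n exp (- T)].

    - In the remaining, heavy, case all nonzero vectors of [W^perp] have large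
      support and [W] is hit by a row with probability more than [exp (- T)].
      Here the entry law is compared with the law of [b (xi - xi')], where [xi]
      and [xi'] are independent with law [q] and [b] is a Bernoulli variable with
      a small constant parameter. [halasz_comparison] shows that a row with
      such lazy entries hits [W] at least 64 times as often as a row of the
      matrix ([heavy_gain]). Now take [m = n / 2] lazy rows, independent of the
      matrix. Given that they lie in [W] they are linearly independent with
      probability at least 1/2, by the bound [odlyzko]; by Steinitz exchange
      they then replace [m] of the rows in a spanning family of [W]. So the
      probability that the row space is [W] is at most [2 * 64^-m] times the sum
      over sets [S] of rows of the probability that the rows in [S] and the lazy
      rows together span [W]. For fixed [S] these events are disjoint as [W]
      varies, and there are [2^n] sets [S], so summing over all heavy [W] loses
      only [2^n] ([Pr_heavy_span]).

    The comparison of hitting probabilities is Fourier-analytic. Both are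
    averages over [t] in [W^perp]: one of quantities at most [exp (- f t / 2)],
    the other of quantities at least [exp (- f t / (2 * 22^7))], where [f] is
    the sum over the coordinates of [1 - |phi (t_i)|^2] and [phi] is the
    characteristic function of [q]. Up to constants [f] is subadditive, and it
    is large somewhere on every nonzero subgroup of [W^perp], because vectors
    there have large support. It follows that the number of [t] with [f t <= s]
    at least doubles when [s] is multiplied by 22 ([lev_double]), and hence that
    the second average exceeds the first by a factor [2^7], up to the term
    [t = 0], which is at most [1 / p], and an exponentially small one. *)

(** * Finite product probability spaces *)

Section FiniteProbability.
Variable R : realFieldType.

Definition dist (T : finType) (q : T -> R) : Prop :=
  (forall x, 0 <= q x) /\ \sum_x q x = 1.

Definition Pr (T : finType) (q : T -> R) (A : pred T) : R := \sum_(x | A x) q x.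

Definition prodw (I T : finType) (q : T -> R) (x : {ffun I -> T}) : R :=
  \prod_i q (x i).

Definition upd (I T : finType) (x : {ffun I -> T}) (i : I) (t : T) :
  {ffun I -> T} := [ffun j => if j == i then t else x j].

Definition local_to (I T : finType) (U : Type) (S : {set I})
    (F : {ffun I -> T} -> U) : Prop :=
  forall x y : {ffun I -> T}, {in S, x =1 y} -> F x = F y.

Section OneSpace.
Variables (T : finType) (q : T -> R).
Hypothesis q_dist : dist q.

Lemma PrE A : Pr q A = \sum_x q x * (A x)%:R.
Proof.
by rewrite /Pr big_mkcond; apply: eq_bigr => x _; case: (A x); rewrite ?mulr1 ?mulr0.
Qed.

Lemma Pr_ge0 A : 0 <= Pr q A.
Proof. by apply: sumr_ge0 => x _; case: q_dist. Qed.

Lemma sub_Pr (A B : pred T) : (forall x, A x -> B x) -> Pr q A <= Pr q B.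
Proof.
move=> AB; rewrite !PrE; apply: ler_sum => x _; apply: ler_wpM2l.
  by case: q_dist.
by rewrite ler_nat; case Ax: (A x) => //; rewrite AB.
Qed.

Lemma Pr_le1 A : Pr q A <= 1.
Proof. by case: q_dist => _ <-; apply: (@sub_Pr A predT). Qed.

Lemma eq_Pr (A B : pred T) : A =1 B -> Pr q A = Pr q B.
Proof. by move=> AB; apply: eq_bigl. Qed.

Lemma Pr_union (J : finType) (P : pred J) (A : pred T) (B : J -> pred T) :
  (forall x, A x -> exists2 j, P j & B j x) ->
  Pr q A <= \sum_(j | P j) Pr q (B j).
Proof.
move=> AB; rewrite PrE; under [leRHS]eq_bigr do rewrite PrE.
rewrite exchange_big /=; apply: ler_sum => x _; rewrite -mulr_sumr.
apply: ler_wpM2l; first by case: q_dist.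
case Ax: (A x); last by apply: sumr_ge0.
have [j Pj Bj] := AB x Ax.
by rewrite (bigD1 j) //= Bj lerDl sumr_ge0.
Qed.

Lemma Pr_setU (A B C : pred T) : (forall x, A x -> B x || C x) ->
  Pr q A <= Pr q B + Pr q C.
Proof.
move=> ABC; rewrite !PrE -big_split /=; apply: ler_sum => x _.
rewrite -mulrDr; apply: ler_wpM2l; first by case: q_dist.
rewrite -natrD ler_nat; move: (ABC x).
by case: (A x); case: (B x); case: (C x) => // /(_ isT).
Qed.

Lemma Pr_disjoint (J : finType) (P : pred J) (B : J -> pred T) :
  (forall x j k, P j -> P k -> B j x -> B k x -> j = k) ->
  \sum_(j | P j) Pr q (B j) <= 1.
Proof.
move=> Bdis; under eq_bigr do rewrite PrE.
rewrite exchange_big /=; have [q0 q1] := q_dist; rewrite -[leRHS]q1.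
apply: ler_sum => x _; rewrite -mulr_sumr -[leRHS]mulr1.
apply: ler_wpM2l => //.
case: (pickP (fun j => P j && B j x)) => [j /andP[Pj Bj]|noj]; last first.
  by rewrite big1 // => j Pj; have := noj j; rewrite Pj /= => ->.
rewrite (bigD1 j) //= Bj big1 ?addr0 // => k /andP[Pk kj].
case Bk: (B k x) => //; have := Bdis x k j Pk Pj Bk Bj.
by move/eqP; rewrite (negPf kj).
Qed.

End OneSpace.

Section Product.
Variables (I T : finType) (q : T -> R).
Hypothesis q_dist : dist q.
Implicit Types (x : {ffun I -> T}).

Lemma prodw_box (A : I -> pred T) :
  Pr (prodw (I := I) q) [pred x : {ffun I -> T} | [forall i, A i (x i)]] = \prod_i Pr q (A i).
Proof.
under [RHS]eq_bigr do rewrite PrE.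
rewrite bigA_distr_bigA PrE; apply: eq_bigr => x _ /=.
rewrite /prodw big_split /=; congr (_ * _).
case: forallP => [Ax|nAx]; first by rewrite big1 // => i _; rewrite Ax.
apply/esym/eqP; rewrite prodf_seq_eq0; apply/hasP => /=.
suff: exists i, ~~ A i (x i).
  by case=> i Ai; exists i; rewrite ?mem_index_enum // (negPf Ai) eqxx.
by apply/existsP; rewrite -negb_forall; apply/negP => /forallP.
Qed.

Lemma prodw_dist : dist (prodw (I := I) q).
Proof.
have [q0 q1] := q_dist; split => [x|]; first exact: prodr_ge0.
rewrite -(bigA_distr_bigA (fun _ t => q t)) /= big1 // => i _.
Qed.

Lemma updE x i t : upd x i t i = t.
Proof. by rewrite ffunE eqxx. Qed.

Lemma upd_local (U : Type) (S : {set I}) (F : {ffun I -> T} -> U) x i t :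
  local_to S F -> i \notin S -> F (upd x i t) = F x.
Proof.
move=> locF iS; apply: locF => j jS; rewrite ffunE; case: eqP => // ji.
by move: iS; rewrite -ji jS.
Qed.

(** Drawing coordinate [i] afresh preserves the product law: exchanging the old
    value of the coordinate with the new one is a weight-preserving involution
    of the pairs (point, new value). This lets one integrate out a coordinate
    without splitting the product space. *)
Lemma resample (i : I) (A : pred {ffun I -> T}) :
  Pr (prodw q) A =
  \sum_x prodw q x * Pr q (fun t => A (upd x i t)).
Proof.
under [RHS]eq_bigr do rewrite PrE mulr_sumr.
rewrite pair_bigA /=.
pose s (u : {ffun I -> T} * T) := (upd u.1 i u.2, u.1 i).
have sK : involutive s.
  case=> x t; rewrite /s /= updE; congr (_, _).
  by apply/ffunP => j; rewrite !ffunE; case: eqP => // ->.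
rewrite (reindex_inj (inv_inj sK)) /= PrE.
rewrite -(pair_bigA _ (fun x t => prodw q (upd x i t) *
   (q (x i) * (A (upd (upd x i t) i (x i)))%:R))) /=.
apply: eq_bigr => x _; have [_ q1] := q_dist.
rewrite -[LHS]mul1r -q1 mulr_suml; apply: eq_bigr => t _.
have -> : upd (upd x i t) i (x i) = x.
  by apply/ffunP => j; rewrite !ffunE; case: eqP => // ->.
rewrite /prodw (bigD1 i) //= [in RHS](bigD1 i) //= updE.
rewrite [X in _ = _ * X * _](eq_bigr (fun j => q (x j))); first by ring.
by move=> j ji; rewrite ffunE (negPf ji).
Qed.

(** Given the coordinates in [S], the others are independent; each of them meets
    its constraint, which may depend on the coordinates in [S], with probability
    at most [h]. The constraints are removed one at a time by resampling. *)
Lemma Pr_local (S : {set I}) (A : pred {ffun I -> T})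
    (G : I -> {ffun I -> T} -> pred T) (h : R) :
    local_to S A -> (forall i u, local_to S (fun x => G i x u)) -> 0 <= h ->
    (forall i x, i \notin S -> A x -> Pr q (G i x) <= h) ->
  Pr (prodw q) [pred x : {ffun I -> T} | A x && [forall i, (i \notin S) ==> G i x (x i)]]
    <= h ^+ #|~: S| * Pr (prodw q) A.
Proof.
move=> locA locG h0 hG.
pose E (B : {set I}) x := A x && [forall i, (i \in B) ==> G i x (x i)].
suff H n (B : {set I}) : #|B| = n -> B \subset ~: S ->
    Pr (prodw q) (E B) <= h ^+ n * Pr (prodw q) A.
  apply: le_trans (H _ (~: S) erefl (subxx _)).
  by rewrite le_eqVlt; apply/orP; left; apply/eqP/eq_Pr => x /=; rewrite /E;
    congr (_ && _); apply: eq_forallb => i; rewrite inE.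
elim: n B => [|n IHn] B cardB sBS.
  rewrite expr0 mul1r; apply: sub_Pr; first exact: prodw_dist.
  by move=> x /andP[].
have [i iB] : exists i, i \in B by apply/set0Pn; rewrite -cards_eq0 cardB.
have iS : i \notin S by have := subsetP sBS i iB; rewrite inE.
have cB' : #|B :\ i| = n by move: cardB; rewrite (cardsD1 i) iB => -[].
have sB' : B :\ i \subset ~: S by apply: subset_trans sBS; apply: subsetDl.
rewrite exprS -mulrA; apply: le_trans (ler_wpM2l h0 (IHn _ cB' sB')).
rewrite (resample i) [in leRHS]PrE mulr_sumr; apply: ler_sum => x _.
rewrite [leRHS]mulrCA; apply: ler_wpM2l; first by case: prodw_dist.
have Aupd t : A (upd x i t) = A x by apply: upd_local locA iS.
have Gupd j t u : G j (upd x i t) u = G j x u.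
  exact: (upd_local x t (locG j u) iS).
case EB: (E (B :\ i) x); last first.
  rewrite mulr0 /Pr big_pred0 // => t; apply/negP => /andP[At /forallP Gt].
  move/negP: EB; apply; rewrite /E -(Aupd t) At; apply/forallP => j.
  apply/implyP; rewrite !inE => /andP[ji jB]; have := Gt j.
  by rewrite jB Gupd ffunE (negPf ji).
rewrite mulr1; have Ax : A x by case/andP: EB.
apply: le_trans (hG i x iS Ax); apply: sub_Pr => // t /andP[_ /forallP/(_ i)].
by rewrite iB Gupd updE.
Qed.

End Product.
End FiniteProbability.

(** * Row spans and the Odlyzko bound *)

Section Spans.
Variables (F : fieldType) (n : nat) (I : finType).
Implicit Types (x : I -> 'rV[F]_n) (S : {set I}).

Definition rspan x S : 'M[F]_n := (\sum_(i in S) <<x i>>)%MS.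

Lemma rspan_sup x S i : i \in S -> (x i <= rspan x S)%MS.
Proof. by move=> iS; apply: (sumsmx_sup i) => //; rewrite genmxE. Qed.

Lemma rspan_sub x S m (W : 'M[F]_(m, n)) :
  (forall i, i \in S -> (x i <= W)%MS) -> (rspan x S <= W)%MS.
Proof. by move=> xW; apply/sumsmx_subP => i /xW; rewrite genmxE. Qed.

Lemma rspanS x S S' : S \subset S' -> (rspan x S <= rspan x S')%MS.
Proof. by move/subsetP=> sub; apply: rspan_sub => i /sub; apply: rspan_sup. Qed.

Lemma eq_rspan x y S : {in S, x =1 y} -> rspan x S = rspan y S.
Proof. by move=> xy; apply: eq_bigr => i /xy ->. Qed.

(** Steinitz exchange: a largest [S] whose vectors are independent modulo [U]
    spans everything modulo [U]. *)
Lemma basis_exchange x (U : 'M[F]_n) :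
  exists2 S : {set I}, (#|S| + \rank U = \rank (U + rspan x setT)%MS)%N &
    forall i, (x i <= U + rspan x S)%MS.
Proof.
pose good (S : {set I}) := \rank (U + rspan x S)%MS == (#|S| + \rank U)%N.
have good0 : good set0 by rewrite /good /rspan big_set0 addsmx0 cards0.
have [S gS maxS] := @arg_maxnP _ set0 good (fun S => #|S|) good0.
have xS i : (x i <= U + rspan x S)%MS.
  apply/negPn/negP => xi.
  have iS : i \notin S.
    apply: contra xi => iS; apply: submx_trans (addsmxSr _ _); exact: rspan_sup.
  suff /maxS : good (i |: S) by rewrite /= cardsU1 iS add1n /geq /= ltnn.
  have sub : (U + rspan x S < U + rspan x (i |: S))%MS.
    rewrite ltmxE addsmxS ?rspanS ?subsetU1 //; apply: contra xi => /(submx_trans _); apply.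
    by apply: submx_trans (addsmxSr _ _); apply: rspan_sup; rewrite setU11.
  rewrite /good eqn_leq; apply/andP; split; last first.
    by rewrite cardsU1 iS add1n addSn -(eqP gS); apply: rank_ltmx.
  have -> : rspan x (i |: S) = (<<x i>> + rspan x S)%MS by rewrite /rspan big_setU1.
  rewrite addsmxA (addsmxC U) -addsmxA cardsU1 iS add1n addSn -(eqP gS).
  apply: leq_trans (mxrank_adds_leqif _ _).1 _; rewrite mxrank_gen.
  by have := rank_leq_row (x i); case: (\rank (x i)) => [|[|?]].
exists S => //; rewrite -(eqP gS); apply/eqmx_rank/andP; split.
  by apply: addsmxS => //; apply: rspanS; apply: subsetT.
by rewrite addsmx_sub addsmxSl /=; apply: rspan_sub.
Qed.
End Spans.

Section Odlyzko.
Variables (R : realFieldType) (F : finFieldType).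

Definition rv n (x : {ffun 'I_n -> F}) : 'rV[F]_n := \row_j x j.

(** A vector of [U] is determined by [\rank U] of its coordinates, namely those
    of a basis of the column space of [U], so each of the other coordinates has
    to take one prescribed value. *)
Lemma odlyzko (q : F -> R) (h : R) n m (U : 'M[F]_(m, n)) :
    dist q -> (forall t, q t <= h) -> h <= 1 ->
  Pr (prodw q) [pred x : {ffun 'I_n -> F} | (rv x <= U)%MS] <= h ^+ (n - \rank U).
Proof.
move=> q_dist qh h1; have [q0 q1] := q_dist.
have h0 : 0 <= h by apply: le_trans (qh 0).
pose c j := (col j U)^T.
have [S rkS cS] := basis_exchange c 0.
rewrite mxrank0 addn0 adds0mx in rkS.
have leS : (#|S| <= \rank U)%N.
  rewrite rkS -(mxrank_tr U); apply: mxrankS; apply: rspan_sub => i _.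
  by rewrite /c tr_col row_sub.
(* the values that coordinate [i] can take in a vector of [U] agreeing with [x] on [S] *)
pose G i (x : {ffun 'I_n -> F}) : pred F := fun t =>
  [exists y : {ffun 'I_n -> F}, [&& (rv y <= U)%MS, [forall j in S, y j == x j] & y i == t]].
have locG i t : local_to S (fun x => G i x t).
  move=> x y xy; apply: eq_existsb => z; congr [&& _, _ & _].
  by apply: eq_forallb_in => j jS; rewrite xy.
have GP i x : i \notin S -> predT x -> Pr q (G i x) <= h.
  move=> iS _; case: (pickP (G i x)) => [t0 Gt0|noG]; last first.
    by rewrite /Pr big_pred0.
  apply: le_trans (qh t0); rewrite /Pr (eq_bigl (pred1 t0)) ?big_pred1_eq //.
  move=> t; apply/idP/eqP => [|->] //.
  case/existsP: Gt0 => y0 /and3P[/submxP[z0 Uy0] /forall_inP y0x /eqP <-].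
  case/existsP => y /and3P[/submxP[z Uy] /forall_inP yx /eqP <-].
  have yz k : y k - y0 k = ((z - z0) *m col k U) 0 0.
    by rewrite colE mulmxA -colE mulmxBl -Uy -Uy0 !mxE.
  apply/eqP; rewrite -subr_eq0 yz.
  suff /sub_kermxP cz : (c i <= kermx (z - z0)^T)%MS.
    by rewrite -[_ *m _]trmxK trmx_mul cz !mxE.
  have := cS i; rewrite adds0mx => /submx_trans; apply; apply: rspan_sub => j jS.
  apply/sub_kermxP; rewrite -trmx_mul; apply/matrixP => a b.
  by rewrite !ord1 mxE -yz (eqP (yx j jS)) (eqP (y0x j jS)) subrr mxE.
have := Pr_local q_dist (A := predT) (fun _ _ _ => erefl) locG h0 GP.
rewrite (_ : Pr _ predT = 1) ?mulr1; last by case: (prodw_dist 'I_n q_dist).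
have pd := prodw_dist 'I_n q_dist.
move=> H; apply: le_trans (sub_Pr pd _) (le_trans H _).
  move=> x /= Ux; apply/forallP => i; apply/implyP => iS.
  by apply/existsP; exists x; rewrite Ux eqxx andbT; apply/forall_inP.
rewrite cardsCs setCK card_ord.
by rewrite ler_wiXn2l // leq_sub2l.
Qed.
End Odlyzko.

(** * Doubling of sublevel sets and domination of sums *)

Section Doubling.
Variables (R : realFieldType) (V : finZmodType) (f : V -> R) (D : {set V}).
Variable beta : R.

Definition zclosed (H : {set V}) : Prop :=
  (forall t u, t \in H -> u \in H -> t + u \in H) /\
  (forall t, t \in H -> - t \in H).

Hypothesis f_ge0 : forall t, 0 <= f t.
Hypothesis f0 : f 0 = 0.
Hypothesis fN : forall t, f (- t) = f t.
Hypothesis fD : forall t u, f (t + u) <= 2 * f t + 2 * f u.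
Hypothesis D_closed : zclosed D.
Hypothesis D0 : 0 \in D.
Hypothesis f_big : forall H : {set V}, H \subset D -> zclosed H ->
  (exists2 t, t \in H & t != 0) -> exists2 t, t \in H & beta <= f t.

Definition lev (s : R) : {set V} := [set t in D | f t <= s].

Lemma levS s s' : s <= s' -> lev s \subset lev s'.
Proof.
move=> ss'; apply/subsetP => t; rewrite !inE => /andP[-> /=] ts.
exact: le_trans ts ss'.
Qed.

(** Otherwise [lev (4 * s)] is stable under translation by [lev s], because
    [f (h + t) <= 2 s + 8 s]; its stabiliser is then a nonzero subgroup on which
    [f <= 4 s < beta]. *)
Lemma lev_gap s t0 : 4 * s < beta -> t0 \in lev s -> t0 != 0 ->
  exists2 t, t \in D & 4 * s < f t <= 10 * s.
Proof.
move=> sb t0s t0N0.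
have s0 : 0 <= s by move: t0s; rewrite inE => /andP[_]; apply: le_trans.
suff /subsetPn[t] : ~~ (lev (10 * s) \subset lev (4 * s)).
  by rewrite !inE => /andP[tD ts]; rewrite tD /= -ltNge => ts'; exists t; rewrite ?ts'.
apply/negP => sub; have [DD DN] := D_closed.
pose H := [set h in D | [forall t in lev (4 * s), h + t \in lev (4 * s)]].
have HP h t : h \in H -> t \in lev (4 * s) -> h + t \in lev (4 * s).
  by rewrite inE => /andP[_ /forall_inP]; apply.
have zero4 : 0 \in lev (4 * s) by rewrite inE D0 f0; lra.
have H4 h : h \in H -> h \in lev (4 * s) by move/HP/(_ zero4); rewrite addr0.
have HD : H \subset D by apply/subsetP => h; rewrite inE => /andP[].
have Hc : zclosed H.
  split=> [t u tH uH|t tH].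
    rewrite inE DD ?(subsetP HD) //=; apply/forall_inP => v v4.
    by rewrite -addrA !HP.
  rewrite inE DN ?(subsetP HD) //=; apply/forall_inP => v.
  have levN w : (- w \in lev (4 * s)) = (w \in lev (4 * s)).
    rewrite !inE fN; congr (_ && _); apply/idP/idP => /DN //.
    by rewrite opprK.
  by rewrite -levN => /(HP _ _ tH); rewrite -levN opprB addrC.
have [|t tH] := f_big HD Hc.
  exists t0 => //; move: t0s; rewrite !inE => /andP[t0D t0s]; rewrite t0D /=.
  apply/forall_inP => v; rewrite inE => /andP[vD v4]; apply: (subsetP sub).
  by rewrite inE DD //=; have := fD t0 v; lra.
by move/H4: tH; rewrite inE => /andP[_]; lra.
Qed.

(** If [4 s < f t <= 10 s], the translate of [lev s] by [t] is disjoint from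
    [lev s], where [f <= s], since [f t <= 2 f (t + a) + 2 f a]; and it lies in
    [lev (22 * s)], since [f (t + a) <= 20 s + 2 s]. *)
Lemma lev_double s t0 : 4 * s < beta -> t0 \in lev s -> t0 != 0 ->
  (2 * #|lev s| <= #|lev (22 * s)|)%N.
Proof.
move=> sb t0s t0N0; have [DD DN] := D_closed.
have s0 : 0 <= s by move: t0s; rewrite inE => /andP[_]; apply: le_trans.
have [t tD /andP[t4 t10]] := lev_gap sb t0s t0N0.
pose B := [set t + a | a in lev s].
have cB : #|B| = #|lev s| by rewrite card_imset //; apply: addrI.
rewrite mul2n -addnn -{2}cB -cardsUI.
have -> : lev s :&: B = set0.
  apply/setP => v; rewrite !inE; apply/negP => /andP[/andP[vD vs] /imsetP[a]].
  rewrite inE => /andP[aD as_] vE; have := fD v (- a); rewrite fN vE addrK.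
  by rewrite -vE; lra.
rewrite cards0 addn0; apply: subset_leq_card; apply/subsetP => v.
rewrite inE => /orP[|/imsetP[a]].
  by apply/subsetP/levS; lra.
rewrite !inE => /andP[aD as_] ->; rewrite DD //=.
by have := fD t a; lra.
Qed.

Lemma lev_growth j s t0 : 4 * (22 ^+ j * s) < beta -> t0 \in lev s -> t0 != 0 ->
  (2 ^ j * #|lev s| <= #|lev (22 ^+ j * s)|)%N.
Proof.
have s0 : t0 \in lev s -> 0 <= s by rewrite inE => /andP[_]; apply: le_trans.
elim: j => [|j IHj] sb t0s t0N0; first by rewrite mul1n expr0 mul1r.
have {}s0 := s0 t0s.
have p0 : 1 <= 22 ^+ j :> R by apply: exprn_ege1; lra.
have sj : s <= 22 ^+ j * s by rewrite -[leLHS]mul1r; apply: ler_wpM2r.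
have sb' : 4 * (22 ^+ j * s) < beta by move: sb; rewrite exprS -mulrA; nra.
rewrite expnS -mulnA exprS -mulrA.
apply: leq_trans (lev_double sb' (subsetP (levS sj) _ t0s) t0N0).
by rewrite leq_mul2l IHj.
Qed.

End Doubling.

(** Summation by parts, arranged as an induction on [#|A|]: at a point [a] where
    [g] is largest, [Phi] splits into the constant [Phi (g a)] and the positive
    part of [Phi - Phi (g a)]. The constant is controlled by the counting
    hypothesis at [a], and the positive part vanishes at [a], so that the
    induction hypothesis applies to it on [A :\ a]. *)
Lemma sum_domination (R : realFieldType) (V : finType) (K : nat) (A B : {set V})
    (g h : V -> R) (Phi : R -> R) :
    (forall x y, x <= y -> Phi y <= Phi x) -> (forall x, 0 <= Phi x) ->
    (forall a, a \in A ->
       (K * #|[set a' in A | (g a' <= g a)%R]| <= #|[set b in B | (h b <= g a)%R]|)%N) ->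
  K%:R * \sum_(a in A) Phi (g a) <= \sum_(b in B) Phi (h b).
Proof.
have [N] := ubnP #|A|; elim: N => // N IHN in A Phi *.
move=> cA Phi_dec Phi0 dom.
have [->|[a1 a1A]] := set_0Vmem A.
  by rewrite big_set0 mulr0; apply: sumr_ge0.
have [a aA a_max] := @arg_maxP _ _ _ a1 (fun t => t \in A) g a1A.
pose M := g a; pose Psi x := Num.max (Phi x - Phi M) 0.
have Psi_dec x y : x <= y -> Psi y <= Psi x.
  by move=> /Phi_dec xy; rewrite /Psi ge_max !le_max lexx orbT andbT lerB ?xy.
have Psi0 x : 0 <= Psi x by rewrite le_max lexx orbT.
pose A' := A :\ a.
have cA' : (#|A'| < N)%N by move: cA; rewrite (cardsD1 a) aA.
have IH : K%:R * \sum_(a in A') Psi (g a) <= \sum_(b in B) Psi (h b).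
  apply: IHN => // c; rewrite !inE => /andP[ca cAA].
  apply: leq_trans (dom c cAA); rewrite leq_mul2l; apply/orP; right.
  by apply: subset_leq_card; apply/subsetP => v; rewrite !inE => /andP[/andP[_ ->]].
have sumA : \sum_(b in A) Phi (g b) = #|A|%:R * Phi M + \sum_(b in A') Psi (g b).
  rewrite [\sum_(b in A') _](_ : _ = \sum_(b in A) Psi (g b)); last first.
    by rewrite [RHS](big_setD1 a) //= /Psi subrr maxxx add0r.
  rewrite mulr_natl -sumr_const -big_split /=; apply: eq_bigr => b bA.
  rewrite /Psi max_l; first by rewrite addrC subrK.
  by rewrite subr_ge0; apply/Phi_dec/a_max.
pose B0 := [set b in B | h b <= M].
have cB0 : (K * #|A| <= #|B0|)%N.
  apply: leq_trans (dom a aA); rewrite leq_mul2l; apply/orP; right.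
  by apply: subset_leq_card; apply/subsetP => v vA; rewrite inE vA; apply: a_max.
have sumB : #|B0|%:R * Phi M + \sum_(b in B) Psi (h b) <= \sum_(b in B) Phi (h b).
  rewrite mulr_natl -sumr_const big_mkcond [X in _ + X]big_mkcond [leRHS]big_mkcond /=.
  rewrite -big_split /=; apply: ler_sum => b _; rewrite !inE.
  case: (b \in B) => /=; last by rewrite addr0.
  case: (boolP (h b <= M)) => [hb|]; last rewrite -ltNge => hb; rewrite /Psi.
    by rewrite max_l ?subr_ge0 ?Phi_dec // addrC subrK.
  by rewrite add0r max_r ?Phi0 // subr_le0 Phi_dec // ltW.
rewrite sumA mulrDr mulrA -natrM; apply: le_trans sumB; apply: lerD => //.
by apply: ler_wpM2r => //; rewrite ler_nat.
Qed.

(** * Characters of a finite field *)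

Section Characters.
Variables (R : rcfType) (F : finFieldType).
Local Notation C := (complex R).
Local Notation conj := (@conjc R).
Local Notation toC := (real_complex R).
Local Notation re := (@complex.Re R).
Local Notation im := (@complex.Im R).

Definition add_character (e : F -> C) : Prop :=
  [/\ forall x y, e (x + y) = e x * e y, forall x, normc (e x) = 1
    & forall x, x != 0 -> e x != 1].

Variable e : F -> C.
Hypothesis e_char : add_character e.

Let eD : forall x y, e (x + y) = e x * e y. Proof. by case: e_char. Qed.
Let enorm : forall x, normc (e x) = 1. Proof. by case: e_char. Qed.
Let eN1 : forall x, x != 0 -> e x != 1. Proof. by case: e_char. Qed.

Lemma char_neq0 x : e x != 0.
Proof. by apply/eqP => ex0; have := enorm x; rewrite ex0 normc0 => /eqP; rewrite eq_sym oner_eq0. Qed.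

Lemma char0 : e 0 = 1.
Proof. by apply: (mulfI (char_neq0 0)); rewrite -eD addr0 mulr1. Qed.

Lemma mul_conj (z : C) : z * conj z = toC (normc z ^+ 2).
Proof.
case: z => a b /=; rewrite sqr_sqrtr ?addr_ge0 ?sqr_ge0 //.
by apply/eqP; rewrite eq_complex /=; apply/andP; split; apply/eqP; ring.
Qed.

Lemma charN x : e (- x) = conj (e x).
Proof.
apply: (mulfI (char_neq0 x)); rewrite -eD subrr char0 mul_conj enorm.
by rewrite expr1n.
Qed.

Lemma char_sum (I : finType) (f : I -> F) : e (\sum_i f i) = \prod_i e (f i).
Proof. by apply: (big_morph e eD char0). Qed.

(** Half of [|1 - e x|^2]. *)
Definition gap (x : F) : R := 1 - re (e x).

Lemma char_circle x : re (e x) ^+ 2 + im (e x) ^+ 2 = 1.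
Proof.
have := enorm x; case: (e x) => a b /= ab.
by rewrite -(sqr_sqrtr (addr_ge0 (sqr_ge0 a) (sqr_ge0 b))) ab expr1n.
Qed.

Lemma gap_ge0 x : 0 <= gap x.
Proof. have := char_circle x; rewrite /gap; nra. Qed.

Lemma gap0 : gap 0 = 0.
Proof. by rewrite /gap char0 /= subrr. Qed.

Lemma gapN x : gap (- x) = gap x.
Proof. by rewrite /gap charN; case: (e x). Qed.

(** The triangle inequality [|1 - u v| <= |1 - u| + |1 - v|] for [u], [v] on the
    unit circle, squared. *)
Lemma gapD x y : gap (x + y) <= 2 * gap x + 2 * gap y.
Proof.
rewrite /gap eD.
suff H (a b c d : R) : a ^+ 2 + b ^+ 2 = 1 -> c ^+ 2 + d ^+ 2 = 1 ->
    1 - (a * c - b * d) <= 2 * (1 - a) + 2 * (1 - c).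
  have := H _ _ _ _ (char_circle x) (char_circle y).
  by case: (e x) => a b; case: (e y).
move=> ab cd; rewrite -subr_ge0.
(* the difference is half of [|1 - 2 u + u v|^2], for [u = a + i b], [v = c + i d] *)
have -> : 2 * (1 - a) + 2 * (1 - c) - (1 - (a * c - b * d)) =
    ((1 - 2 * a + a * c - b * d) ^+ 2 + (- 2 * b + a * d + b * c) ^+ 2) / 2
  + (1 - (a ^+ 2 + b ^+ 2)) * (2 - 2 * c + (c ^+ 2 + d ^+ 2) / 2)
  + (1 - (c ^+ 2 + d ^+ 2)) / 2 by field.
by rewrite ab cd subrr !mul0r !addr0 divr_ge0 ?addr_ge0 ?sqr_ge0.
Qed.

Lemma re_sum (I : Type) (r : seq I) (P : pred I) (z : I -> C) :
  re (\sum_(i <- r | P i) z i) = \sum_(i <- r | P i) re (z i).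
Proof. by apply: (big_morph re) => [[a b] [c d]|]. Qed.

Lemma re_le_normc (z : C) : re z <= normc z.
Proof.
case: z => a b /=; apply: le_trans (ler_norm a) _; rewrite -sqrtr_sqr.
by rewrite ler_wsqrtr // lerDl sqr_ge0.
Qed.

Lemma normc_prod (I : finType) (z : I -> C) :
  normc (\prod_i z i) = \prod_i normc (z i).
Proof. exact: (big_morph _ (@normcM R) (normc1 R)). Qed.

Section Averages.
Variables (V : finZmodType) (H : {set V}) (psi : V -> F).
Hypothesis H_closed : zclosed H.
Hypothesis psiD : forall t u, psi (t + u) = psi t + psi u.
Variable t1 : V.
Hypothesis t1H : t1 \in H.
Hypothesis psi_t1 : psi t1 != 0.

(** Translating the sum by [t1] multiplies it by [e (psi t1)], which is not 1. *)
Lemma char_sum0 : \sum_(t in H) e (psi t) = 0.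
Proof.
have [HD HN] := H_closed.
have : (e (psi t1) - 1) * \sum_(t in H) e (psi t) = 0.
  rewrite mulrBl mul1r mulr_sumr; apply/eqP; rewrite subr_eq0; apply/eqP.
  rewrite [RHS](reindex_inj (addIr t1)) /=; apply: eq_big => [t|t tH].
    apply/idP/idP => [tH|/HD]; first exact: HD.
    by move/(_ _ (HN _ t1H)); rewrite addrK.
  by rewrite psiD eD mulrC.
by move/eqP; rewrite mulf_eq0 subr_eq0 (negPf (eN1 psi_t1)) /= => /eqP.
Qed.

Lemma gap_sum : \sum_(t in H) gap (psi t) = #|H|%:R.
Proof.
rewrite /gap sumrB sumr_const -re_sum char_sum0 /=.
by rewrite subr0.
Qed.
End Averages.

Section Law.
Variable q : F -> R.
Hypothesis q_dist : dist q.

Definition phi (s : F) : C := \sum_x toC (q x) * e (s * x).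

(** Equal to [1 - |phi s|^2] by [normc_phi]; in this form it inherits the
    quasi-subadditivity of [gap]. *)
Definition defect (s : F) : R := \sum_x \sum_y q x * q y * gap (s * (x - y)).

Lemma sum_pairs : \sum_x \sum_y q x * q y = 1.
Proof.
have [_ q1] := q_dist; rewrite -[RHS]q1; apply: eq_bigr => x _.
by rewrite -mulr_sumr q1 mulr1.
Qed.

Lemma phi_conj s : phi s * conj (phi s) =
  \sum_x \sum_y toC (q x * q y) * e (s * (x - y)).
Proof.
have -> : conj (phi s) = \sum_y toC (q y) * e (- (s * y)).
  apply: etrans (rmorph_sum _ _ _ _) _; apply: eq_bigr => y _.
  apply: etrans (rmorphM _ _ _) _; rewrite charN; congr (_ * _).
  exact: conjc_real.
rewrite /phi mulr_suml; apply: eq_bigr => x _.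
rewrite mulr_sumr; apply: eq_bigr => y _.
rewrite mulrBr eD rmorphM; ring.
Qed.

Lemma normc_phi s : normc (phi s) ^+ 2 = 1 - defect s.
Proof.
have -> : normc (phi s) ^+ 2 = re (phi s * conj (phi s)) by rewrite mul_conj.
rewrite phi_conj re_sum -sum_pairs /defect -sumrB; apply: eq_bigr => x _.
rewrite re_sum -sumrB; apply: eq_bigr => y _.
by rewrite /gap; case: (e _) => a b /=; ring.
Qed.

Lemma defect_ge0 s : 0 <= defect s.
Proof.
have [q0 _] := q_dist.
by apply: sumr_ge0 => x _; apply: sumr_ge0 => y _; rewrite !mulr_ge0 ?gap_ge0.
Qed.

Lemma defect_le1 s : defect s <= 1.
Proof. by rewrite -subr_ge0 -normc_phi sqr_ge0. Qed.

Lemma defect0 : defect 0 = 0.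
Proof.
by rewrite /defect big1 // => x _; rewrite big1 // => y _; rewrite mul0r gap0 mulr0.
Qed.

Lemma defectN s : defect (- s) = defect s.
Proof.
by apply: eq_bigr => x _; apply: eq_bigr => y _; rewrite mulNr gapN.
Qed.

Lemma defectD s u : defect (s + u) <= 2 * defect s + 2 * defect u.
Proof.
have [q0 _] := q_dist.
rewrite /defect !mulr_sumr -big_split /=; apply: ler_sum => x _.
rewrite !mulr_sumr -big_split /=; apply: ler_sum => y _.
rewrite mulrDl; have qq : 0 <= q x * q y by rewrite mulr_ge0.
have := ler_wpM2l qq (gapD (s * (x - y)) (u * (x - y))); lra.
Qed.

Section Vectors.
Variable n : nat.
Implicit Types t : 'rV[F]_n.

Definition energy t : R := \sum_i defect (t 0 i).

Definition supp t : {set 'I_n} := [set i | t 0 i != 0].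

Lemma energy_ge0 t : 0 <= energy t.
Proof. by apply: sumr_ge0 => i _; apply: defect_ge0. Qed.

Lemma energy0 : energy 0 = 0.
Proof. by rewrite /energy big1 // => i _; rewrite mxE defect0. Qed.

Lemma energyN t : energy (- t) = energy t.
Proof. by apply: eq_bigr => i _; rewrite mxE defectN. Qed.

Lemma energyD t u : energy (t + u) <= 2 * energy t + 2 * energy u.
Proof.
rewrite /energy !mulr_sumr -big_split /=; apply: ler_sum => i _.
by rewrite mxE defectD.
Qed.

Lemma off_diagonal (al : R) : (forall x, q x <= 1 - al) ->
  al <= \sum_x \sum_(y | y != x) q x * q y.
Proof.
move=> qal; have [q0 q1] := q_dist.
have -> : al = \sum_x q x * al by rewrite -mulr_suml q1 mul1r.
apply: ler_sum => x _; rewrite -mulr_sumr; apply: ler_wpM2l => //.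
have := qal x; move: q1; rewrite (bigD1 x) //=; lra.
Qed.

(** Average over [H]: if coordinate [i] is not identically zero on [H] and
    [x != y], then [gap (t_i * (x - y))] has mean 1, so the mean of the energy is
    at least the number of such coordinates times the probability, at least
    [al], that two independent draws from [q] differ. *)
Lemma energy_big (al : R) (K : nat) (H : {set 'rV[F]_n}) :
    (forall x, q x <= 1 - al) -> 0 <= al -> zclosed H ->
    (exists2 t, t \in H & (K <= #|supp t|)%N) ->
  exists2 t, t \in H & al * K%:R <= energy t.
Proof.
move=> qal al0 Hc [t1 t1H Kt1]; have [q0 _] := q_dist.
apply/exists_inP; rewrite -[X in is_true X]negbK negb_exists_in; apply/negP.
move=> /forall_inP small.
have H0 : 0 < #|H|%:R :> R by rewrite ltr0n; apply/card_gt0P; exists t1.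
have : \sum_(t in H) energy t < \sum_(t in H) al * K%:R.
  by apply: ltr_sum => [|t /small]; [apply/hasP; exists t1; rewrite ?mem_index_enum | rewrite ltNge].
apply/negP; rewrite -leNgt sumr_const -[leLHS]mulr_natr.
rewrite /energy exchange_big /=.
apply: (@le_trans _ _ (\sum_(i in supp t1) al * #|H|%:R)).
  rewrite sumr_const -[leRHS]mulr_natr mulrAC; apply: ler_wpM2l.
    by rewrite mulr_ge0 // ltW.
  by rewrite ler_nat.
rewrite [leRHS](bigID (mem (supp t1))) /= -[leLHS]addr0; apply: lerD; last first.
  by apply: sumr_ge0 => i _; apply: sumr_ge0 => t _; apply: defect_ge0.
apply: ler_sum => i; rewrite inE => ti; rewrite /defect exchange_big /=.
apply: le_trans (ler_wpM2r (ltW H0) (off_diagonal qal)) _.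
rewrite mulr_suml; apply: ler_sum => x _; rewrite exchange_big /=.
rewrite mulr_suml [leRHS](bigID (fun y => y != x)) /= -[leLHS]addr0; apply: lerD; last first.
  apply: sumr_ge0 => y _; apply: sumr_ge0 => t _.
  by rewrite !mulr_ge0 ?gap_ge0.
apply: ler_sum => y yx; rewrite -mulr_sumr; apply: ler_wpM2l; first by rewrite mulr_ge0.
rewrite (gap_sum Hc (psi := fun t => t 0 i * (x - y)) _ t1H) // => [t u|].
  by rewrite mxE mulrDl.
by rewrite mulf_neq0 // subr_eq0 eq_sym.
Qed.

Definition perp m (W : 'M[F]_(m, n)) : {set 'rV[F]_n} :=
  [set t | W *m t^T == 0].

Lemma perp_closed m (W : 'M[F]_(m, n)) : zclosed (perp W).
Proof.
split=> [t u|t]; rewrite !inE ?linearD ?linearN /= ?mulmxDr ?mulmxN.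
  by move=> /eqP -> /eqP ->; rewrite addr0.
by rewrite oppr_eq0.
Qed.

Lemma perp0 m (W : 'M[F]_(m, n)) : 0 \in perp W.
Proof. by rewrite inE trmx0 mulmx0. Qed.

Lemma perp_char m (W : 'M[F]_(m, n)) (x : 'rV[F]_n) :
  \sum_(t in perp W) e ((x *m t^T) 0 0) =
  toC (#|perp W|%:R * (x <= W)%MS%:R).
Proof.
case: (boolP (x <= W)%MS) => [/submxP[z ->]|xW].
  rewrite (eq_bigr (fun _ => 1)) ?sumr_const ?mulr1 ?rmorph_nat // => t.
  by rewrite inE => /eqP Wt; rewrite -mulmxA Wt mulmx0 mxE char0.
rewrite mulr0 rmorph0.
have : x *m cokermx W != 0 by rewrite -submxE.
case/matrix0Pn => i [j]; rewrite ord1 => xj.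
apply: (@char_sum0 _ _ (fun t => (x *m t^T) 0 0) _ _ (col j (cokermx W))^T).
- exact: perp_closed.
- by move=> t u; rewrite linearD /= mulmxDr mxE.
- by rewrite inE trmxK colE mulmxA mulmx_coker mul0mx.
- by rewrite trmxK colE mulmxA -colE mxE.
Qed.

(** The indicator of [x <= W] is the mean of the characters [x |-> e (x . t)]
    over [t] in [perp W]; for a product law the mean of such a character
    factorises. *)
Lemma fourier_inversion m (W : 'M[F]_(m, n)) :
  toC (#|perp W|%:R *
       Pr (prodw q) [pred x : {ffun 'I_n -> F} | (rv x <= W)%MS]) =
  \sum_(t in perp W) \prod_i phi (t 0 i).
Proof.
under [RHS]eq_bigr do rewrite /phi bigA_distr_bigA.
rewrite exchange_big /= PrE mulr_sumr rmorph_sum; apply: eq_bigr => x _ /=.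
rewrite mulrCA rmorphM /= -perp_char mulr_sumr; apply: eq_bigr => t _.
rewrite big_split /= -rmorph_prod -char_sum; congr (_ * e _).
by rewrite mxE; apply: eq_bigr => i _; rewrite !mxE mulrC.
Qed.

End Vectors.
End Law.
End Characters.

(** * Comparison of hitting probabilities for a law and its lazy symmetrisation *)

Section Halasz.
Variables (R : realType) (F : finFieldType).
Local Notation C := (complex R).
Local Notation toC := (real_complex R).
Variable e : F -> C.
Hypothesis e_char : add_character e.
Variable q : F -> R.
Hypothesis q_dist : dist q.

(** The law of [b * (x - y)] for independent [x], [y] of law [q] and a Bernoulli
    variable [b] of parameter [mu]. Its characteristic function
    [1 - mu * (1 - |phi|^2)] is real and close to 1. *)
Definition lazy_law (mu : R) (z : F) : R :=
  (1 - mu) * (z == 0)%:R + mu * \sum_x q x * q (x - z).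

Lemma shift_sum (f : F -> R) x : \sum_z f (x - z) = \sum_z f z.
Proof.
rewrite [RHS](reindex_inj (inv_inj (subKr x))) /=; exact: eq_bigr.
Qed.

Lemma lazy_dist mu : 0 <= mu <= 1 -> dist (lazy_law mu).
Proof.
have [q0 q1] := q_dist; move=> /andP[mu0 mu1]; split => [z|].
  rewrite addr_ge0 ?mulr_ge0 ?subr_ge0 //.
  by apply: sumr_ge0 => x _; rewrite mulr_ge0.
rewrite big_split /= -!mulr_sumr exchange_big /=.
rewrite (bigD1 0) //= eqxx big1 => [|z /negPf -> //].
under eq_bigr do rewrite -mulr_sumr shift_sum q1 mulr1.
by rewrite q1 addr0 !mulr1 subrK.
Qed.

Lemma lazy_atom mu al z : 0 <= mu <= 1 -> (forall x, q x <= 1 - al) ->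
  lazy_law mu z <= 1 - mu * al.
Proof.
have [q0 q1] := q_dist; move=> /andP[mu0 mu1] qal.
have S1 : \sum_x q x * q (x - z) <= 1 - al.
  have -> : 1 - al = \sum_x q x * (1 - al) by rewrite -mulr_suml q1 mul1r.
  apply: ler_sum => x _.
  exact: ler_wpM2l.
have := ler_wpM2l mu0 S1; rewrite /lazy_law; case: eqP => _; rewrite ?mulr1 ?mulr0; lra.
Qed.

Lemma phi_lazy mu s : phi e (lazy_law mu) s = toC (1 - mu * defect e q s).
Proof.
have re_pairs : toC (1 - defect e q s) =
    \sum_x \sum_y toC (q x * q y) * e (s * (x - y)).
  by rewrite -normc_phi // -mul_conj phi_conj.
have -> : toC (1 - mu * defect e q s) = toC (1 - mu) + toC mu * toC (1 - defect e q s).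
  by rewrite -rmorphM -rmorphD /=; congr (toC _); ring.
rewrite re_pairs /phi /lazy_law.
under eq_bigr do rewrite rmorphD mulrDl.
rewrite big_split /=; congr (_ + _).
  rewrite (bigD1 0) //= eqxx mulr1 mulr0 (char0 e_char) mulr1 big1 ?addr0 // => z /negPf ->.
  by rewrite mulr0 rmorph0 mul0r.
rewrite mulr_sumr.
under [RHS]eq_bigr => x _.
  rewrite (reindex_inj (inv_inj (subKr x))) /=.
  under eq_bigr do rewrite subKr.
  over.
rewrite -mulr_sumr exchange_big mulr_sumr /=; apply: eq_bigr => z _.
rewrite rmorphM rmorph_sum -mulrA; congr (_ * _).
by rewrite mulr_suml.
Qed.

Lemma normc_phi_exp s : normc (phi e q s) <= expR (- defect e q s / 2).
Proof.
rewrite -(ler_pXn2r (n := 2)) ?nnegrE ?expR_ge0 //; last first.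
  by case: (phi e q s) => a b; apply: sqrtr_ge0.
rewrite normc_phi // -expRM_natl.
rewrite mulrC divfK ?pnatr_eq0 //.
exact: expR_ge1Dx.
Qed.

Lemma exp_le_lin (x : R) : 0 <= x <= 1 / 2 -> expR (- (2 * x)) <= 1 - x.
Proof.
move=> /andP[x0 x2]; rewrite expRN -[leLHS]mul1r ler_pdivrMr ?expR_gt0 //.
have := expR_ge1Dx (2 * x) => h; nra.
Qed.

(** With [f] the energy, the first probability is a mean over [perp W] of terms
    at most [exp (- f / 2)], the second of terms at least
    [exp (- f / (2 * 22^j))]. Split the first mean according to [t = 0], which
    contributes [1 / #|perp W|]; to [22^j f t] at least a quarter of
    [beta = al * K], where the terms are exponentially small; and to the rest
    [D1], on which [lev_growth] provides the counting hypothesis of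
    [sum_domination] with the factor [2^j]. *)
Lemma halasz_comparison (j n m K : nat) (al : R) (W : 'M[F]_(m, n)) :
    (forall x, q x <= 1 - al) -> 0 <= al ->
    (forall t, t \in perp W -> t != 0 -> (K <= #|supp t|)%N) ->
  Pr (prodw q) [pred x : {ffun 'I_n -> F} | (rv x <= W)%MS] <=
    #|perp W|%:R^-1 + expR (- (al * K%:R) / (8 * 22 ^+ j))
    + 2 ^- j * Pr (prodw (lazy_law (4 * 22 ^+ j)^-1))
                [pred x : {ffun 'I_n -> F} | (rv x <= W)%MS].
Proof.
move=> qal al0 dense; set D := perp W; set kk : R := 22 ^+ j; set mu := (4 * kk)^-1.
set N : R := #|D|%:R; set PX := Pr _ _; set PY := Pr _ _.
pose f (t : 'rV[F]_n) := energy e q t.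
pose beta := al * K%:R.
have kk1 : 1 <= kk by apply: exprn_ege1; lra.
have kkE : 22 ^+ j = kk by [].
clearbody kk; have kk0 : 0 < kk by lra.
have N0 : 0 < N by rewrite ltr0n; apply/card_gt0P; exists 0; apply: perp0.
have mu4 : mu * kk = 1 / 4 by rewrite /mu; field; lra.
have mu0 : 0 <= mu by rewrite invr_ge0; lra.
have mul : mu <= 1 / 4 by nra.
pose Phi (x : R) := expR (- x / 2).
have Phi_dec x y : x <= y -> Phi y <= Phi x by move=> xy; rewrite ler_expR; lra.
have Phi0 x : 0 <= Phi x by apply: expR_ge0.
have sX : N * PX <= \sum_(t in D) Phi (f t).
  have -> : N * PX = complex.Re (toC (N * PX)) by [].
  rewrite (fourier_inversion e_char) re_sum; apply: ler_sum => t _.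
  apply: le_trans (re_le_normc _) _; rewrite normc_prod.
  have -> : Phi (f t) = \prod_i expR (- defect e q (t 0 i) / 2).
    by rewrite -expR_sum -mulr_suml sumrN.
  apply: ler_prod => i _; rewrite normc_phi_exp andbT.
  by case: (phi _ _ _) => a b; apply: sqrtr_ge0.
have sY : \sum_(t in D) Phi (f t / kk) <= N * PY.
  have -> : N * PY = complex.Re (toC (N * PY)) by [].
  have Yd : dist (lazy_law mu) by apply: lazy_dist; rewrite mu0; lra.
  rewrite (fourier_inversion e_char) re_sum; apply: ler_sum => t _.
  under eq_bigr do rewrite phi_lazy.
  rewrite -rmorph_prod /=.
  have -> : Phi (f t / kk) = \prod_i expR (- (2 * (mu * defect e q (t 0 i)))).
    rewrite -expR_sum sumrN -!mulr_sumr; congr (expR _); rewrite -/(energy e q t) -/(f t).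
    have -> : mu = 1 / (4 * kk) by rewrite /mu div1r.
    by field; lra.
  apply: ler_prod => i _; rewrite expR_ge0 /=; apply: exp_le_lin.
  have := defect_le1 e_char q_dist (t 0 i); have := defect_ge0 e_char q_dist (t 0 i).
  by move=> d0 d1; apply/andP; split; nra.
pose D1 := [set t in D | (t != 0) && (4 * (kk * f t) < beta)].
have dom : (2 ^ j)%:R * \sum_(t in D1) Phi (f t) <= \sum_(t in D) Phi (f t / kk).
  apply: sum_domination => // a; rewrite inE => /and3P[aD aN0 ab].
  apply: leq_trans (_ : 2 ^ j * #|lev f D (f a)| <= _)%N.
    rewrite leq_mul2l; apply/orP; right; apply: subset_leq_card.
    by apply/fintype.subsetP => v; rewrite !inE => /andP[/andP[-> _] ->].
  have -> : [set b in D | f b / kk <= f a] = lev f D (22 ^+ j * f a).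
    by rewrite kkE; apply/setP => v; rewrite !inE ler_pdivrMr // mulrC.
  apply: (@lev_growth _ _ f D beta _ _ _ _ _ _ _ j (f a) a) => //.
  - exact: energy_ge0.
  - exact: energy0.
  - exact: energyN.
  - exact: energyD.
  - exact: perp_closed.
  - exact: perp0.
  - move=> H HD Hc [t tH t0]; apply: (energy_big e_char q_dist qal al0 Hc).
    by exists t => //; apply: dense => //; apply: (fintype.subsetP HD).
  - by rewrite kkE.
  - by rewrite inE aD lexx.
have split : \sum_(t in D) Phi (f t) <=
    1 + \sum_(t in D1) Phi (f t) + N * expR (- beta / (8 * kk)).
  rewrite (big_setD1 0) ?perp0 //= {1}/f energy0 // {1}/Phi oppr0 mul0r expR0.
  rewrite -addrA lerD2l (bigID (fun t => 4 * (kk * f t) < beta)) /=; apply: lerD.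
    rewrite le_eqVlt; apply/orP; left; apply/eqP; apply: eq_bigl => t.
    by rewrite !inE; case: (t != 0); rewrite ?andbF ?andbT.
  rewrite /N mulr_natl -sumr_const [leRHS]big_mkcond [leLHS]big_mkcond /=.
  apply: ler_sum => t _; rewrite !inE.
  case: (W *m t^T == 0); rewrite ?andbF //= ?andbT.
  case: (t != 0) => /=; last exact: expR_ge0.
  rewrite -leNgt; case: ifP => [tb|_]; last exact: expR_ge0.
  have : beta / (8 * kk) <= f t / 2 by rewrite ler_pdivrMr; lra.
  by rewrite ler_expR !mulNr lerN2.
have p2 : 0 < (2 ^ j)%:R :> R by rewrite ltr0n expn_gt0.
rewrite -(ler_pM2l N0); apply: le_trans sX _; apply: le_trans split _.
rewrite !mulrDr divff ?gt_eqF // -addrA -addrA lerD2l addrC -/beta lerD2l mulrCA.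
rewrite -natrX ler_pdivlMl //; exact: le_trans dom sY.
Qed.

End Halasz.

(** * Kernel vectors of small support *)

Section Anticoncentration.
Variables (R : realFieldType).

(** The extreme case is when [q] and [r] are both carried by the same two points,
    with masses [A], [1 - A] and [B], [1 - B]. If [r] has an atom [x] above 1/2,
    everything else pairs to at most [(1 - q x) * (1 - r x)]; otherwise the
    pairing is at most 1/2, which the right-hand side exceeds. *)
Lemma pairing_bound (T : finType) (q r : T -> R) (A B : R) :
    dist q -> (forall x, 0 <= r x) -> \sum_x r x <= 1 ->
    (forall x, q x <= A) -> (forall x, r x <= B) -> 1 / 2 <= A -> 1 / 2 <= B ->
  \sum_x q x * r x <= A * B + (1 - A) * (1 - B).
Proof.
move=> [q0 q1] r0 r1 qA rB A2 B2.
have AB2 : 1 / 2 <= A * B + (1 - A) * (1 - B) by nra.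
case: (boolP [exists x, 1 / 2 < r x]) => [/existsP[x hx]|]; last first.
  rewrite negb_exists => /forallP rsmall; apply: le_trans AB2.
  rewrite -[leRHS]mul1r -[X in X * _]q1 mulr_suml; apply: ler_sum => x _.
  by apply: ler_wpM2l => //; rewrite leNgt.
rewrite (bigD1 x) //=; move: r1; rewrite (bigD1 x) //= => r1.
move: q1; rewrite (bigD1 x) //= => q1.
have sq : \sum_(i | i != x) q i * r i <= (1 - q x) * \sum_(i | i != x) r i.
  rewrite mulr_sumr; apply: ler_sum => y yx; apply: ler_wpM2r => //.
  rewrite -q1 [q x + _]addrC addrK (bigD1 y) //= lerDl; exact: sumr_ge0.
have qx1 : q x <= 1 by rewrite -q1 lerDl sumr_ge0.
have := qA x; have := rB x; have := q0 x => h1 h2 h3.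
have sr : (1 - q x) * \sum_(i | i != x) r i <= (1 - q x) * (1 - r x).
  by apply: ler_wpM2l; lra.
have : (A - q x) * (2 * r x - 1) >= 0 by apply: mulr_ge0; lra.
have : (B - r x) * (2 * A - 1) >= 0 by apply: mulr_ge0; lra.
lra.
Qed.

(** Adding one independent term to a sum replaces a bound [b] on its atoms by
    [(1 - al) * b + al * (1 - b)], by [pairing_bound]; the bias [2 b - 1] is
    thereby multiplied by [1 - 2 al]. Two-valued uniform variables over ['F_2]
    show that one cannot go below 1/2 without restricting the field. *)
Lemma linear_form_atom (F : finFieldType) (I : finType) (q : F -> R) (al : R)
    (v : I -> F) (B : {set I}) (a : F) :
    dist q -> (forall x, q x <= 1 - al) -> 0 <= al <= 1 / 2 ->
    {in B, forall i, v i != 0} ->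
  Pr (prodw q) [pred x : {ffun I -> F} | \sum_(i in B) x i * v i == a]
    <= (1 + (1 - 2 * al) ^+ #|B|) / 2.
Proof.
move=> q_dist qal /andP[al0 al2].
have pd := prodw_dist I q_dist.
have [k] := ubnP #|B|; elim: k => // k IHk in B a * => /ltnSE cB vB.
have [->|[i iB]] := set_0Vmem B.
  rewrite cards0 expr0; apply: le_trans (Pr_le1 pd _) _; lra.
pose B' := B :\ i; have cBB : #|B| = #|B'|.+1 by rewrite (cardsD1 i) iB.
have vi : v i != 0 by apply: vB.
pose r t := Pr (prodw q)
  [pred x : {ffun I -> F} | \sum_(j in B') x j * v j == a - t * v i].
have rB t : r t <= (1 + (1 - 2 * al) ^+ #|B'|) / 2.
  apply: IHk; first by rewrite -cBB.
  by move=> j; rewrite !inE => /andP[_]; apply: vB.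
have r1 : \sum_t r t <= 1.
  apply: Pr_disjoint => // x t u _ _ /= /eqP -> /eqP /addrI /oppr_inj.
  exact: mulIf.
have r0 t : 0 <= r t by apply: Pr_ge0.
have -> : Pr (prodw q) [pred x : {ffun I -> F} | \sum_(i in B) x i * v i == a] =
    \sum_t q t * r t.
  rewrite (resample q_dist i) /r.
  under [RHS]eq_bigr do rewrite PrE mulr_sumr.
  rewrite exchange_big /=; apply: eq_bigr => x _.
  rewrite PrE mulr_sumr; apply: eq_bigr => t _ /=.
  rewrite mulrCA; congr (_ * (_ * (nat_of_bool _)%:R)).
  rewrite (big_setD1 i) //= updE (eq_bigr (fun j => x j * v j)) => [|j].
    by rewrite [RHS]eq_sym subr_eq [RHS]eq_sym addrC.
  by rewrite !inE ffunE => /andP[/negPf ->].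
have p0 : 0 <= (1 - 2 * al) ^+ #|B'| by apply: exprn_ge0; lra.
apply: le_trans (pairing_bound q_dist r0 r1 qal rB _ _) _; try lra.
rewrite cBB exprS; lra.
Qed.

End Anticoncentration.

Section SparseKernel.
Variables (R : realFieldType) (F : finFieldType) (n : nat).
Implicit Types (x : {ffun 'I_n -> {ffun 'I_n -> F}}) (v : 'rV[F]_n).

Definition orth (y : {ffun 'I_n -> F}) v : bool := \sum_j y j * v 0 j == 0.

Lemma orthE y v : orth y v = (rv y <= kermx v^T)%MS.
Proof.
apply/eqP/sub_kermxP => [yv|]; last first.
  by move/matrixP/(_ 0 0); rewrite [RHS]mxE => h; rewrite -[RHS]h mxE; apply: eq_bigr => j _; rewrite !mxE.
apply/matrixP => a b; rewrite !ord1 !mxE -[RHS]yv.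
by apply: eq_bigr => j _; rewrite !mxE.
Qed.

Lemma mxrank_rspan (I : finType) (x : I -> 'rV[F]_n) (S : {set I}) :
  (\rank (rspan x S) <= #|S|)%N.
Proof.
rewrite /rspan -sum1_card; elim/big_rec2: _ => [|i d W _ IH]; first by rewrite mxrank0.
apply: leq_trans (mxrank_adds_leqif _ _).1 _.
by rewrite leq_add // mxrank_gen rank_leq_row.
Qed.

Definition sparse_kernel (K : nat) x : bool :=
  [exists v : 'rV[F]_n, [&& v != 0, (#|supp v| <= K)%N & [forall i, orth (x i) v]]].

(** A choice of [v] that depends on the rows in [I] only, so that [Pr_local]
    applies to the other rows. *)
Definition candidate (A I : {set 'I_n}) x : option 'rV[F]_n :=
  [pick v | (supp v == A) && [forall i in I, orth (x i) v]].

Lemma candidate_local A I : local_to I (candidate A I).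
Proof.
move=> x y xy; apply: eq_pick => v; congr (_ && _).
by apply: eq_forallb_in => i iI; rewrite xy.
Qed.

Definition witness (A I : {set 'I_n}) x : bool :=
  (candidate A I x : bool) &&
  [forall i, (i \notin I) ==> orth (x i) (odflt 0 (candidate A I x))].

(** Let [v] be a sparse kernel vector and [A] its support. The rows restricted
    to [A] are orthogonal to [v], so their rank is less than [#|A|], and a basis
    [I] of them determines which vectors supported on [A] are orthogonal to all
    rows. The candidate for [(A, I)], which need not be [v], is one of these. *)
Lemma sparse_witness K x : sparse_kernel K x ->
  exists2 P : {set 'I_n} * {set 'I_n},
    [&& (0 < #|P.1| <= K)%N & (#|P.2| < #|P.1|)%N] & witness P.1 P.2 x.
Proof.
case/existsP => v /and3P[v0 vK /forallP xv]; pose A := supp v.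
pose y i : 'rV[F]_n := \row_j (if j \in A then x i j else 0).
(* for vectors supported on [A], the rows may be replaced by their restrictions [y i] to [A] *)
have orthA i u : supp u = A -> orth (x i) u = (y i <= kermx u^T)%MS.
  move=> uA; rewrite orthE; apply/sub_kermxP/sub_kermxP => /matrixP /(_ 0 0) h;
    apply/matrixP => a b; rewrite !ord1 -[RHS]h !mxE; apply: eq_bigr => j _; rewrite !mxE;
    have := in_set (fun j => u 0 j != 0) j; rewrite -/(supp u) uA => ->;
    by case: (eqVneq (u 0 j) 0) => [->|//]; rewrite !mulr0.
have [I rkI yI] := basis_exchange y 0.
rewrite mxrank0 addn0 adds0mx in rkI.
have Agt0 : (0 < #|A|)%N.
  apply/card_gt0P; move/eqP: v0 => v0.
  case: (pickP (mem A)) => [j jA|noA]; first by exists j.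
  case: v0; apply/rowP => j; have := noA j; rewrite !inE mxE.
  by move/negbFE/eqP.
pose dl (j : 'I_n) : 'rV[F]_n := delta_mx 0 j.
have IA : (#|I| < #|A|)%N.
  rewrite rkI; apply: leq_trans (mxrank_rspan dl A).
  apply: rank_ltmx; rewrite ltmxE; apply/andP; split.
    apply: rspan_sub => i _; rewrite [y i]row_sum_delta; apply: summx_sub => j _.
    rewrite mxE; case: ifP => jA; last by rewrite scale0r sub0mx.
    by apply: scalemx_sub; apply: (rspan_sup dl jA).
  apply/negP => sub; case/card_gt0P: Agt0 => j jA.
  have : (dl j <= kermx v^T)%MS.
    apply: submx_trans (rspan_sup dl jA) _.
    apply: submx_trans sub _; apply: rspan_sub => i _.
    by rewrite -orthA ?xv.
  move/sub_kermxP; rewrite -rowE => /matrixP/(_ 0 0); rewrite !mxE.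
  by apply/eqP; move: jA; rewrite inE.
exists (A, I); rewrite /= ?Agt0 ?vK ?IA // /witness.
rewrite /candidate; case: pickP => [u /andP[/eqP uA /forall_inP uI]|/(_ v)]; last first.
  by rewrite eqxx; case/negP; apply/forall_inP => i _.
apply/forallP => i; apply/implyP => _ /=; rewrite orthA //.
have := yI i; rewrite adds0mx => /submx_trans; apply; apply: rspan_sub => j jI.
by rewrite -orthA ?uI.
Qed.

Lemma Pr_witness (q : F -> R) (al : R) (A I : {set 'I_n}) :
    dist q -> (forall z, q z <= 1 - al) -> 0 <= al <= 1 / 2 ->
  Pr (prodw (prodw q)) (witness A I)
    <= ((1 + (1 - 2 * al) ^+ #|A|) / 2) ^+ (n - #|I|).
Proof.
move=> q_dist qal al01; have rd := prodw_dist 'I_n q_dist.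
have rd2 := prodw_dist 'I_n rd.
set h := (_ / 2); have h0 : 0 <= h.
  rewrite /h divr_ge0 // addr_ge0 // exprn_ge0 //; case/andP: al01; lra.
have := Pr_local rd (S := I) (A := fun x => candidate A I x : bool)
  (G := fun i x t => orth t (odflt 0 (candidate A I x))) _ _ h0 _.
rewrite cardsCs setCK card_ord => H; apply: le_trans (H _ _ _) _ => {H}.
- by move=> x y /candidate_local ->.
- by move=> i u x y /candidate_local ->.
- move=> i x _; rewrite /candidate; case: pickP => //= v /andP[/eqP vA _] _.
  rewrite /h -vA; apply: le_trans _ (linear_form_atom (v := fun j => v 0 j) 0 q_dist qal al01 _).
    apply: sub_Pr => // y /eqP /= yv; apply/eqP; rewrite -[RHS]yv [RHS](bigID (mem (supp v))) /=.
    by rewrite [X in _ + X]big1 ?addr0 // => j; rewrite inE negbK => /eqP ->; rewrite mulr0.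
  by move=> j; rewrite inE.
- by rewrite ler_piMr ?exprn_ge0 // Pr_le1.
Qed.

Lemma Pr_sparse_kernel (q : F -> R) (al : R) (K : nat) :
    dist q -> (forall z, q z <= 1 - al) -> 0 <= al <= 1 / 2 ->
  Pr (prodw (prodw q)) (sparse_kernel K) <=
  \sum_(P : {set 'I_n} * {set 'I_n} |
        [&& (0 < #|P.1| <= K)%N & (#|P.2| < #|P.1|)%N])
    ((1 + (1 - 2 * al) ^+ #|P.1|) / 2) ^+ (n - #|P.2|).
Proof.
move=> q_dist qal al01; have rd := prodw_dist 'I_n q_dist.
have rd2 := prodw_dist 'I_n rd.
apply: le_trans (Pr_union rd2 (@sparse_witness K)) _.
by apply: ler_sum => P _; apply: Pr_witness.
Qed.

End SparseKernel.

(** * Swapping rows of the matrix *)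

Section Rows.
Variables (R : realFieldType) (F : finFieldType) (n : nat).
Local Notation V := {ffun 'I_n -> F}.

Definition rows (I : finType) (x : {ffun I -> V}) (S : {set I}) : 'M[F]_n :=
  rspan (fun i => rv (x i)) S.

Lemma rows_local (I : finType) (S : {set I}) :
  local_to S (fun x : {ffun I -> V} => rows x S).
Proof. by move=> x y xy; apply: eq_rspan => i iS; rewrite xy. Qed.

Lemma dependent_row (I : finType) (x : {ffun I -> V}) :
  (\rank (rows x setT) < #|I|)%N ->
  exists i, (rv (x i) <= rows x (~: [set i]))%MS.
Proof.
have [S rkS xS] := basis_exchange (fun i => rv (x i)) 0.
rewrite mxrank0 addn0 adds0mx in rkS; rewrite /rows -rkS => ltS.
have [i iS] : exists i, i \notin S.
  apply/existsP; rewrite -negb_forall; apply: contraL ltS => /forallP allS.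
  by rewrite -leqNgt -cardsT subset_leq_card //; apply/subsetP => i _.
exists i; have := xS i; rewrite adds0mx => /submx_trans; apply; apply: rspanS.
by apply/subsetP => j jS; rewrite !inE; apply: contraNneq iS => <-.
Qed.

Definition hit (q : F -> R) (W : 'M[F]_n) : R :=
  Pr (prodw q) [pred z : V | (rv z <= W)%MS].

Section OneLaw.
Variable q : F -> R.
Hypothesis q_dist : dist q.
Let rd := prodw_dist 'I_n q_dist.

Lemma hitS (W W' : 'M[F]_n) : (W <= W')%MS -> hit q W <= hit q W'.
Proof. by move=> sub; apply: sub_Pr => // z /= /submx_trans; apply. Qed.

(** Some row lies in the span of the others, which is then the whole row space
    and is independent of that row. *)
Lemma Pr_light_span (tau : R) : 0 <= tau ->
  Pr (prodw (prodw q)) [pred x : {ffun 'I_n -> V} |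
     (\rank (rows x setT) < n)%N && (hit q (rows x setT) <= tau)] <= n%:R * tau.
Proof.
move=> tau0; have rd2 := prodw_dist 'I_n rd.
apply: le_trans (Pr_union rd2 (P := predT) (B := fun i => [pred x : {ffun 'I_n -> V} |
   (hit q (rows x (~: [set i])) <= tau) && (rv (x i) <= rows x (~: [set i]))%MS]) _) _.
  move=> x /= /andP[rk light].
  have [|i xi] := @dependent_row _ x; first by rewrite card_ord.
  exists i => //=; rewrite xi andbT; apply: le_trans light; apply: hitS.
  exact/rspanS/subsetT.
rewrite -[n in n%:R]card_ord mulr_natl -sumr_const; apply: ler_sum => i _.
have := Pr_local rd (S := ~: [set i])
  (A := fun x : {ffun 'I_n -> V} => hit q (rows x (~: [set i])) <= tau)
  (G := fun _ x t => (rv t <= rows x (~: [set i]))%MS) _ _ tau0 _.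
rewrite setCK cards1 expr1 => H; apply: le_trans (le_trans _ (H _ _ _)) _ => {H}.
- apply: sub_Pr => // x /= /andP[-> xi] /=; apply/forallP => j.
  by rewrite !inE negbK; apply/implyP => /eqP ->.
- by move=> x y /rows_local ->.
- by move=> _ t x y /rows_local ->.
- by [].
- by rewrite ler_piMr // Pr_le1.
Qed.

(** If [m] rows in [W] are dependent, one of them lies in the span of the other
    [m - 1]; by [odlyzko] this costs [h^(n - m)] instead of [hit q W]. *)
Lemma Pr_independent_in (m : nat) (h : R) (W : 'M[F]_n) :
    (forall t, q t <= h) -> h <= 1 -> m%:R * h ^+ (n - m) <= hit q W / 2 ->
  hit q W ^+ m / 2 <=
  Pr (prodw (prodw q)) [pred y : {ffun 'I_m -> V} |
     [forall j, (rv (y j) <= W)%MS] && (\rank (rows y setT) == m)].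
Proof.
move=> qh h1 small; have rd2 := prodw_dist 'I_m rd.
have h0 : 0 <= h by apply: le_trans (qh 0); case: q_dist.
have H0 : 0 <= hit q W by apply: Pr_ge0.
set b := Pr _ _.
have allW : Pr (prodw (prodw q)) [pred y : {ffun 'I_m -> V} | [forall j, (rv (y j) <= W)%MS]]
    = hit q W ^+ m.
  by rewrite (prodw_box _ (fun _ z => (rv z <= W)%MS)) prodr_const card_ord.
pose dep k := [pred y : {ffun 'I_m -> V} | [forall j, (j != k) ==> (rv (y j) <= W)%MS] &&
  (rv (y k) <= rows y (~: [set k]))%MS].
have depP k : Pr (prodw (prodw q)) (dep k) <= hit q W ^+ m.-1 * h ^+ (n - m).
  have hp0 : 0 <= h ^+ (n - m) by apply: exprn_ge0.
  have := Pr_local rd (S := ~: [set k])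
    (A := fun y : {ffun 'I_m -> V} => [forall j, (j != k) ==> (rv (y j) <= W)%MS])
    (G := fun _ y t => (rv t <= rows y (~: [set k]))%MS) _ _ hp0 _.
  rewrite setCK cards1 expr1 => H; apply: le_trans (le_trans _ (H _ _ _)) _ => {H}.
  - apply: sub_Pr => // y /= /andP[-> yk] /=; apply/forallP => j.
    by rewrite !inE negbK; apply/implyP => /eqP ->.
  - by move=> y z yz; apply: eq_forallb => j; case: eqVneq => //= jk; rewrite yz // !inE.
  - by move=> _ t y z /rows_local ->.
  - move=> i y _ _; apply: le_trans (odlyzko _ q_dist qh h1) _.
    apply: ler_wiXn2l => //; apply: leq_sub2l; apply: leq_trans (mxrank_rspan _ _) _.
    by apply: leq_trans (max_card _) _; rewrite card_ord.
  rewrite mulrC; apply: ler_wpM2r => //.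
  have -> : Pr (prodw (prodw q))
     (fun y : {ffun 'I_m -> V} => [forall j, (j != k) ==> (rv (y j) <= W)%MS]) =
     \prod_(j < m) Pr (prodw q) (fun z => (j != k) ==> (rv z <= W)%MS).
    exact: (prodw_box _ (fun j z => (j != k) ==> (rv z <= W)%MS)).
  rewrite (bigD1 k) //= (_ : Pr _ _ = 1); last by rewrite eqxx; case: rd.
  rewrite mul1r (eq_bigr (fun _ => hit q W)) => [|j ->] //.
  by rewrite prodr_const cardC1 card_ord.
have : hit q W ^+ m <= b + \sum_(k < m) Pr (prodw (prodw q)) (dep k).
  rewrite -allW.
  pose D := [pred y : {ffun 'I_m -> V} | [exists k, dep k y]].
  have DS : Pr (prodw (prodw q)) D <= \sum_(k < m) Pr (prodw (prodw q)) (dep k).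
    by apply: Pr_union => // y /existsP[k yk]; exists k.
  apply: le_trans (_ : b + Pr (prodw (prodw q)) D <= _); last by rewrite lerD2l.
  apply: Pr_setU => // y /= yW; rewrite yW /=; case: eqP => //= /eqP rk.
  have [|k yk] := @dependent_row _ y.
    rewrite card_ord ltn_neqAle rk /=; apply: leq_trans (mxrank_rspan _ _) _.
    by rewrite cardsT card_ord.
  apply/existsP; exists k; rewrite /= yk andbT; apply/forallP => j.
  by rewrite (forallP yW) implybT.
move=> le1; have le2 : \sum_(k < m) Pr (prodw (prodw q)) (dep k) <= hit q W ^+ m / 2.
  apply: le_trans (ler_sum _ (fun k _ => depP k)) _.
  rewrite sumr_const card_ord -[leLHS]mulr_natl.
  case: m small {depP dep le1 allW b rd2} => [|m] small.
    by rewrite mulr0n mul0r expr0 divr_ge0.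
  rewrite mulrCA exprSr -mulrA; apply: ler_wpM2l => //; exact: exprn_ge0.
by move: le1 le2; set X := _ ^+ m; set Z := \sum_(k < m) _; lra.
Qed.
End OneLaw.

Section Swap.
Variables (q qY : F -> R).
Hypothesis q_dist : dist q.
Hypothesis qY_dist : dist qY.
Variable m : nat.
Let rd := prodw_dist 'I_n q_dist.
Let rdY := prodw_dist 'I_n qY_dist.
Let rd2 := prodw_dist 'I_n rd.
Let rdY2 := prodw_dist 'I_m rdY.

Definition mixed_span (S : {set 'I_n}) (y : {ffun 'I_m -> V}) (W : 'M[F]_n) :=
  [pred x : {ffun 'I_n -> V} | (rows y setT + rows x S == W)%MS].

(** By exchange, the rows of [y] together with [dim W - m] rows of [x] span [W],
    and each of the at least [m] rows left over has to hit [W] independently. *)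
Lemma swap_rows (W : 'M[F]_n) (y : {ffun 'I_m -> V}) :
    [forall j, (rv (y j) <= W)%MS] -> \rank (rows y setT) = m ->
  Pr (prodw (prodw q)) [pred x : {ffun 'I_n -> V} | (rows x setT == W)%MS]
  <= hit q W ^+ m * \sum_(S : {set 'I_n}) Pr (prodw (prodw q)) (mixed_span S y W).
Proof.
move=> /forallP yW rky; have H0 : 0 <= hit q W by apply: Pr_ge0.
pose E (S : {set 'I_n}) (x : {ffun 'I_n -> V}) := mixed_span S y W x &&
  [forall i, (i \notin S) ==> (rv (x i) <= W)%MS].
apply: (@le_trans _ _ (\sum_(S : {set 'I_n} | (#|S| + m <= n)%N)
    Pr (prodw (prodw q)) (E S))).
  apply: Pr_union => // x /= /eqmxP xW.
  have [S rkS xS] := basis_exchange (fun i => rv (x i)) (rows y setT).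
  exists S; first by rewrite -[X in (_ + X)%N]rky rkS rank_leq_col.
  have sW i : (rv (x i) <= W)%MS by rewrite -xW; apply: (rspan_sup (fun i => rv (x i))); rewrite inE.
  apply/andP; split; last by apply/forallP => i; rewrite sW implybT.
  rewrite /=; apply/andP; split.
    by rewrite addsmx_sub; apply/andP; split; apply: rspan_sub => *; [apply: yW|apply: sW].
  by rewrite -xW; apply: rspan_sub => i _; apply: xS.
rewrite mulr_sumr big_mkcond /=; apply: ler_sum => S _.
case: ifP => cS; last by rewrite mulr_ge0 ?exprn_ge0 ?Pr_ge0.
have := Pr_local rd (S := S) (A := mixed_span S y W)
  (G := fun _ _ t => (rv t <= W)%MS) _ _ H0 _.
rewrite cardsCs setCK card_ord => H; apply: le_trans (H _ _ _) _ => {H} //.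
- by move=> x z /rows_local /= ->.
- apply: ler_wpM2r; first exact: Pr_ge0.
  apply: ler_wiXn2l => //; first exact: Pr_le1.
  rewrite -(leq_add2l #|S|) subnKC //; exact: leq_trans (leq_addr _ _) cS.
Qed.

(** Multiply the probability of row space [W] by the probability, at least
    [hit qY W ^ m / 2], that [m] rows of law [qY] are independent in [W], and
    apply [swap_rows]: the factor [(hit q W / hit qY W)^m] is at most [eps^m].
    For a fixed set [S] of rows the events in [mixed_span] exclude one another
    for different [W], so the sum over [W] costs 1 per [S]. *)
Lemma Pr_heavy_span (good : pred 'M[F]_n) (eps h : R) :
    (forall t, qY t <= h) -> h <= 1 -> 0 <= eps ->
    (forall W, good W -> [/\ 0 < hit qY W, hit q W <= eps * hit qY W
                           & m%:R * h ^+ (n - m) <= hit qY W / 2]) ->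
  Pr (prodw (prodw q)) [pred x : {ffun 'I_n -> V} | good <<rows x setT>>%MS]
  <= 2 * eps ^+ m * 2 ^+ n.
Proof.
move=> qYh h1 eps0 goodP.
pose a (W : 'M[F]_n) := Pr (prodw (prodw q)) [pred x : {ffun 'I_n -> V} | (rows x setT == W)%MS].
(* matrices equal to their own [genmx] represent each subspace exactly once *)
pose gen W := good W && (<<W>>%MS == W).
apply: (@le_trans _ _ (\sum_(W | gen W) a W)).
  apply: Pr_union => // x /= gx; exists <<rows x setT>>%MS.
    by rewrite /gen gx genmx_id eqxx.
  by apply/eqmxP/eqmx_sym/genmxE.
pose Q (W : 'M[F]_n) := \sum_(S : {set 'I_n}) \sum_(y : {ffun 'I_m -> V})
   prodw (prodw qY) y * Pr (prodw (prodw q)) (mixed_span S y W).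
have aQ W : gen W -> a W <= 2 * eps ^+ m * Q W.
  case/andP=> /goodP [Y0 XY small] _.
  pose b := Pr (prodw (prodw qY)) [pred y : {ffun 'I_m -> V} |
     [forall j, (rv (y j) <= W)%MS] && (\rank (rows y setT) == m)].
  have lower : hit qY W ^+ m / 2 <= b by apply: Pr_independent_in small.
  have upper : a W * b <= hit q W ^+ m * Q W.
    rewrite /b PrE mulr_sumr /Q exchange_big mulr_sumr /=; apply: ler_sum => y _.
    rewrite -mulr_sumr mulrCA [leRHS]mulrCA; apply: ler_wpM2l.
      by case: rdY2.
    case: andP => [[yW /eqP rky]|_]; last first.
      rewrite mulr0; apply: mulr_ge0; first by apply/exprn_ge0/Pr_ge0.
      by apply: sumr_ge0 => S _; apply: Pr_ge0.
    by rewrite mulr1; apply: swap_rows.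
  have a0 : 0 <= a W by apply: Pr_ge0.
  have Q0 : 0 <= Q W.
    apply: sumr_ge0 => S _; apply: sumr_ge0 => y _.
    by apply: mulr_ge0; [case: rdY2 | apply: Pr_ge0].
  have p0 : 0 < hit qY W ^+ m by apply: exprn_gt0.
  have X0 : 0 <= hit q W by apply: Pr_ge0.
  have pm : hit q W ^+ m <= eps ^+ m * hit qY W ^+ m.
    by rewrite -exprMn; apply: lerXn2r; rewrite ?nnegrE ?mulr_ge0 // ltW.
  rewrite -(ler_pM2r p0).
  have := ler_wpM2l a0 lower; have := ler_wpM2r Q0 pm; lra.
apply: le_trans (ler_sum _ aQ) _; rewrite -mulr_sumr.
apply: ler_wpM2l; first by rewrite mulr_ge0 ?exprn_ge0.
rewrite /Q exchange_big /=.
have -> : 2 ^+ n = #|{set 'I_n}|%:R :> R.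
  by rewrite -cardsT -powersetT card_powerset cardsT card_ord natrX.
rewrite -sumr_const; apply: ler_sum => S _; rewrite exchange_big /=.
have [_ s1] := rdY2; rewrite -[leRHS]s1; apply: ler_sum => y _; rewrite -mulr_sumr.
rewrite -[leRHS]mulr1; apply: ler_wpM2l; first by case: rdY2.
apply: Pr_disjoint => // x W W' /andP[_ /eqP gW] /andP[_ /eqP gW'] /= e1 e2.
rewrite -gW -gW'; apply/genmxP/eqmxP.
exact: eqmx_trans (eqmx_sym (eqmxP e1)) (eqmxP e2).
Qed.

End Swap.
End Rows.

(** * Summing over small supports *)

Section Numerics.
Variable R : realType.

Lemma sum_subsets (n : nat) (a : R) :
  \sum_(S : {set 'I_n}) a ^+ #|S| = (1 + a) ^+ n.
Proof.
rewrite -[in RHS](card_ord n) -prodr_const addrC bigA_distr.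
apply: eq_bigr => S _; rewrite -prodr_const big_mkcond /=.
by apply: eq_bigr => i _.
Qed.

(** Both branches come from [(1 - 2 al)^k <= exp (- 2 x) <= 1 / (1 + 2 x)] with
    [x = al * k]. *)
Lemma atom_decay (al : R) (k : nat) : 0 <= al <= 1 / 2 ->
  (1 + (1 - 2 * al) ^+ k) / 2 <=
  (if al * k%:R <= 1 then expR (- (al * k%:R) / 3) else expR (- (1 / 3))).
Proof.
move=> /andP[al0 al2]; pose x := al * k%:R.
have x0 : 0 <= x by apply: mulr_ge0.
have p1 : (1 - 2 * al) ^+ k <= expR (- (2 * x)).
  have -> : - (2 * x) = k%:R * - (2 * al) by rewrite /x; ring.
  rewrite expRM_natl; apply: lerXn2r; rewrite ?nnegrE ?expR_ge0 //; first lra.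
  by apply: le_trans (expR_ge1Dx _); lra.
have p2 : expR (- (2 * x)) * (1 + 2 * x) <= 1.
  rewrite expRN mulrC ler_pdivrMr ?expR_gt0 // mul1r; exact: expR_ge1Dx.
have e0 := expR_ge0 (- (2 * x)).
rewrite -/x; case: ifP => [x1|/negbT]; last rewrite -ltNge => x1.
  apply: le_trans (expR_ge1Dx _); nra.
by apply: le_trans (expR_ge1Dx _); nra.
Qed.

Lemma exp_pow (x : R) (k : nat) : expR x ^+ k = expR (x * k%:R).
Proof. by rewrite expRM_natr. Qed.

(** Each term is at most a constant times [z^(#|P.1| + #|P.2|)] for a [z] with
    [(1 + z)^(2n)] under control, so that no binomial coefficient has to be
    estimated. When [al * k <= 1], [z = 1 / n] works: the loss [n^(2k)] is
    absorbed by [exp (- al k n / 6)]. When [al * k > 1], the term is at most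
    [exp (- n / 6)] and [z = 1 / 48] works: as [k <= n / 48^2] and
    [48 <= exp 48], the loss [48^(2k)] is at most [exp (n / 24)]. *)
Lemma sparse_sum (n : nat) (al : R) : (4 <= n)%N -> 0 < al <= 1 / 2 ->
    48 * ln n%:R <= al * n%:R ->
  \sum_(P : {set 'I_n} * {set 'I_n} |
        [&& (0 < #|P.1| <= n %/ 2304)%N & (#|P.2| < #|P.1|)%N])
    ((1 + (1 - 2 * al) ^+ #|P.1|) / 2) ^+ (n - #|P.2|)
  <= 10 * expR (- (al * n%:R) / 12).
Proof.
move=> n4 /andP[al0 al2] big; set N : R := n%:R in big *.
have N4 : 4 <= N by rewrite ler_nat.
have lnN : expR (ln N) = N by rewrite lnK // posrE; lra.
have L0 : 0 <= ln N by apply: ln_ge0; lra.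
pose a := expR (- (al * N) / 12); pose b := expR (- N / 8).
have a0 : 0 <= a by apply: expR_ge0.
have b0 : 0 <= b by apply: expR_ge0.
have al01 : 0 <= al <= 1 / 2 by rewrite ltW.
apply: (@le_trans _ _ (\sum_(P : {set 'I_n} * {set 'I_n})
    (a * (N^-1 ^+ #|P.1| * N^-1 ^+ #|P.2|) + b * (48^-1 ^+ #|P.1| * 48^-1 ^+ #|P.2|)))).
  rewrite big_mkcond /=; apply: ler_sum => -[A I] _ /=.
  have Ni : 0 <= N^-1 by rewrite invr_ge0; lra.
  have t1 : 0 <= a * (N^-1 ^+ #|A| * N^-1 ^+ #|I|) by rewrite !mulr_ge0 ?exprn_ge0.
  have t2 : 0 <= b * (48^-1 ^+ #|A| * 48^-1 ^+ #|I|) by rewrite !mulr_ge0 ?exprn_ge0 ?invr_ge0.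
  case: ifP => [/andP[/andP[A0 AK] IA]|_]; last exact: addr_ge0.
  move: (#|A|) (#|I|) A0 AK IA t1 t2 => k i k0 kK ik t1 t2.
  have kn : k%:R * 2304 <= N :> R.
    rewrite -natrM ler_nat; apply: leq_trans (leq_trunc_div n 2304).
    by rewrite leq_mul2r kK orbT.
  have ik' : i%:R <= k%:R :> R by rewrite ler_nat ltnW.
  have k1 : 1 <= k%:R :> R by rewrite ler1n.
  have ni : (n - i)%:R = N - i%:R :> R.
    by rewrite natrB // -(ler_nat R) -/N; lra.
  have ni2 : N / 2 <= N - i%:R by lra.
  have base0 : 0 <= (1 + (1 - 2 * al) ^+ k) / 2.
    by rewrite divr_ge0 // addr_ge0 // exprn_ge0 //; lra.
  have := atom_decay k al01; case: ifP => hk /(lerXn2r (n - i)); 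
    rewrite !nnegrE => /(_ base0 (expR_ge0 _)) /le_trans; apply; rewrite exp_pow ni.
    apply: le_trans (_ : a * (N^-1 ^+ k * N^-1 ^+ i) <= _); last by rewrite lerDl.
    rewrite -[in leRHS]lnN -expRN !exp_pow -!expRD ler_expR.
    have h1 : al * k%:R * (N / 2) <= al * k%:R * (N - i%:R).
      by apply: ler_wpM2l => //; rewrite mulr_ge0 // ltW.
    have h2 : al * N <= k%:R * (al * N) by rewrite ler_peMl // mulr_ge0 ?ltW //; lra.
    have h3 : k%:R * (48 * ln N) <= k%:R * (al * N) by apply: ler_wpM2l.
    have h4 : ln N * i%:R <= ln N * k%:R by apply: ler_wpM2l.
    lra.
  apply: le_trans (_ : b * (48^-1 ^+ k * 48^-1 ^+ i) <= _); last by rewrite lerDr.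
  have e48 : expR (- 48) <= 48^-1 :> R.
    rewrite expRN lef_pV2 ?posrE ?expR_gt0 //.
    by apply: le_trans (expR_ge1Dx _); lra.
  have e48n j : expR (- 48 * j%:R) <= 48^-1 ^+ j :> R.
    by rewrite -exp_pow; apply: lerXn2r; rewrite ?nnegrE ?expR_ge0 ?invr_ge0.
  apply: le_trans (_ : b * (expR (- 48 * k%:R) * expR (- 48 * i%:R)) <= _); last first.
    by apply: ler_wpM2l => //; apply: ler_pM => //; apply: expR_ge0.
  by rewrite -!expRD ler_expR; lra.
rewrite big_split /= -!mulr_sumr.
have pairsum (z : R) : \sum_(P : {set 'I_n} * {set 'I_n}) z ^+ #|P.1| * z ^+ #|P.2| =
    (1 + z) ^+ n * (1 + z) ^+ n.
  rewrite -(pair_bigA _ (fun A I : {set 'I_n} => z ^+ #|A| * z ^+ #|I|)) /=.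
  under eq_bigr do rewrite -mulr_sumr sum_subsets.
  by rewrite -mulr_suml sum_subsets.
rewrite !pairsum.
have one z : 0 <= z -> (1 + z) ^+ n <= expR (z * N).
  move=> z0; rewrite -exp_pow; apply: lerXn2r; rewrite ?nnegrE ?expR_ge0 ?addr_ge0 //.
  exact: expR_ge1Dx.
(* [e^(1/8) <= 8/7], and [(8/7)^16] is about 8.5 *)
have e9 : expR 2 <= 9 :> R.
  have e8 : expR (1 / 8) <= 8 / 7 :> R.
    have h := expR_ge1Dx (- (1 / 8) : R); rewrite expRN in h.
    rewrite -[leRHS]invrK -[leLHS]invrK lef_pV2 ?posrE ?invr_gt0 ?expR_gt0 //; lra.
  have -> : expR 2 = expR (1 / 8) ^+ 16 :> R by rewrite exp_pow; congr expR; field.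
  apply: le_trans (_ : (8 / 7) ^+ 16 <= _); last lra.
  by apply: lerXn2r; rewrite ?nnegrE ?expR_ge0.
have prodN : (1 + N^-1) ^+ n * (1 + N^-1) ^+ n <= 9.
  apply: le_trans e9; have Ni : 0 <= N^-1 by rewrite invr_ge0; lra.
  have := one _ Ni; rewrite mulVf; last by apply: lt0r_neq0; lra.
  move=> h; apply: le_trans (ler_pM _ _ h h) _; rewrite ?exprn_ge0 ?addr_ge0 //.
  by rewrite -expRD.
have b48 : b * ((1 + 48^-1) ^+ n * (1 + 48^-1) ^+ n) <= a.
  have h := one 48^-1 _; rewrite invr_ge0 ler0n in h; have {}h := h isT.
  apply: le_trans (ler_wpM2l b0 (ler_pM _ _ h h)) _; rewrite ?exprn_ge0 ?addr_ge0 ?invr_ge0 //.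
  rewrite -!expRD ler_expR; nra.
have := ler_wpM2l a0 prodN; rewrite -/a; lra.
Qed.
End Numerics.

(** * The characters of a prime field *)

Section PrimeCharacter.
Variables (R : realType) (p : nat).
Hypothesis p_prime : prime p.

(** A root of [1 + X + ... + X^(p-1)]; it is not 1 because [p] is not 0 in
    characteristic zero. *)
Lemma root_of_unity : exists2 z : complex R, z ^+ p = 1 & z != 1.
Proof.
have p1 := prime_gt1 p_prime.
pose f : {poly complex R} := \poly_(i < p) 1.
have sf : size f = p.
  by rewrite size_poly_eq // oner_eq0.
have [z /rootP fz] : exists z, root f z.
  by apply/closed_rootP; rewrite sf gtn_eqF.
have fE : \sum_(i < p) z ^+ i = 0.
  by apply: etrans _ fz; rewrite horner_poly; apply: eq_bigr => i _; rewrite mul1r.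
exists z; first by apply/eqP; rewrite -subr_eq0 subrX1 fE mulr0.
apply: contraPneq fE => ->; under eq_bigr do rewrite expr1n.
rewrite sumr_const card_ord; apply/eqP.
by rewrite pnatr_eq0 -lt0n prime_gt0.
Qed.

Lemma exists_character : exists e : 'F_p -> complex R, add_character e.
Proof.
have [z zp z1] := root_of_unity; exists (fun x => z ^+ (x : nat)).
have zmod k : z ^+ (k %% p) = z ^+ k by apply: expr_mod.
have eD (x y : 'F_p) : z ^+ (x + y)%R = z ^+ x * z ^+ y.
  rewrite -exprD -(zmod (x + y)%N); congr (z ^+ _).
  by rewrite /=; congr (modn _ _); exact: Fp_cast.
split=> // [x|x x0].
  have nz : normc z ^+ p = 1.
    have -> : normc z ^+ p = normc (z ^+ p) by elim: (p) => [|k IH]; rewrite ?normc1 // !exprS normcM IH.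
    by rewrite zp normc1.
  have nz1 : normc z = 1.
    apply/eqP; rewrite -(pexpr_eq1 (n := p)) ?nz //; first exact: prime_gt0.
    by case: (z) => a b; apply: sqrtr_ge0.
  by elim: (x : nat) => [|k IH]; rewrite ?normc1 // exprS normcM IH mulr1.
apply: contra z1 => /eqP ex.
have ek k : z ^+ (x *+ k : 'F_p)%R = 1.
  by elim: k => [|k IH]; rewrite ?mulr0n // mulrS eD ex IH mulr1.
have := ek (x^-1 : 'F_p)%R; rewrite -mulr_natr natr_Zp mulfV //.
by rewrite /= Fp_cast // modn_small ?prime_gt1 // expr1 => ->.
Qed.
End PrimeCharacter.

(** * Singularity modulo a large prime *)

(** The orthogonal contains a line. *)
Lemma card_perp (F : finFieldType) n (W : 'M[F]_n) :
  (\rank W < n)%N -> (#|F| <= #|perp W|)%N.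
Proof.
move=> rk; have : cokermx W != 0 by rewrite -mxrank_eq0 mxrank_coker subn_eq0 -ltnNge.
case/matrix0Pn => i [j cij]; pose t : 'rV[F]_n := (col j (cokermx W))^T.
have t0 : t 0 i != 0 by rewrite mxE mxE.
rewrite -(card_imset (f := fun a : F => a *: t)) => [|a b /= /rowP/(_ i) h].
  apply: subset_leq_card; apply/fintype.subsetP => _ /imsetP[a _ ->].
  by rewrite inE linearZ /= -scalemxAr trmxK colE mulmxA mulmx_coker mul0mx scaler0.
by apply: (mulIf t0); move: h; rewrite mxE [RHS]mxE.
Qed.

Section Assembly.
Variables (R : realType).

(** The exponential rate. The factor [2304] is the inverse of the density that
    separates small from large supports, [22^7] comes from seven doublings in
    [lev_growth], and [16] leaves room in the exponents compared below. *)
Definition rate : R := (16 * 2304 * 22 ^+ 7)^-1.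

Lemma rate_gt0 : 0 < rate.
Proof.
rewrite invr_gt0; apply: mulr_gt0; last by apply: exprn_gt0; rewrite ltr0n.
by apply: mulr_gt0; rewrite ltr0n.
Qed.

Lemma rate_scales (N al dd kk T L : R) :
    0 < al <= 1 / 2 -> 4 <= N -> 1 <= dd -> 1 <= kk -> 0 <= L -> 8 * L <= T ->
    T = (16 * dd * kk)^-1 * al * N ->
  [/\ 48 * L <= al * N, T <= al * N / 12, 16 * T <= N,
      al * (N / dd) = 16 * kk * T & 4 * T <= (4 * kk)^-1 * (al * N)].
Proof.
move=> /andP[al0 al2] N4 dd1 kk1 L0 LT TE.
have T0 : 0 <= T by lra.
have alN : al * N = 16 * dd * kk * T by rewrite TE; field; rewrite !gt_eqF //; lra.
have dkT : T <= dd * kk * T by apply: ler_peMl => //; nra.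
have alN2 : al * N <= 1 / 2 * N by apply: ler_wpM2r => //; lra.
have big : 16 * T <= al * N by rewrite alN; lra.
split; [lra | lra | lra | |].
  by rewrite mulrA alN; field; rewrite gt_eqF //; lra.
have -> : (4 * kk)^-1 * (al * N) = 4 * (dd * T) by rewrite alN; field; rewrite gt_eqF //; lra.
by rewrite ler_pM2l // ler_peMl.
Qed.

Lemma half_bounds (n : nat) : (4 <= n)%N ->
  [/\ n./2 <= n, n <= (n - n./2) * 2 & n.+1 + n <= 6 * n./2]%N.
Proof. by move=> n4; split; lia. Qed.

Lemma decay_bounds (N T : R) : 4 <= N -> 8 * ln N <= T ->
  N * expR (- T / 2) <= 1 / 64 /\ expR (- T / 2) <= 1 / 256.
Proof.
move=> N4 TN; have N0 : 0 < N by lra.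
have lnN : expR (ln N) = N by rewrite lnK.
have h : expR (- T / 2) <= N^-1 ^+ 4.
  by rewrite -[in leRHS]lnN -expRN exp_pow ler_expR; lra.
have z4 : N^-1 <= 4^-1 by rewrite lef_pV2 ?posrE.
have z0 : 0 <= N^-1 by rewrite invr_ge0 ltW.
have pz (k : nat) : N^-1 ^+ k <= 4^-1 ^+ k.
  by apply: lerXn2r; rewrite ?nnegrE ?z0 ?invr_ge0.
split; last by apply: le_trans h (le_trans (pz 4) _); lra.
apply: le_trans (ler_wpM2l (ltW N0) h) _.
have -> : N * N^-1 ^+ 4 = (N * N^-1) * N^-1 ^+ 3 by ring.
by rewrite divff ?gt_eqF //; have := pz 3%N; lra.
Qed.

(** The gain [64^-m] over half of the rows beats the [2^n] choices of [S]: for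
    [n >= 4] one has [6 * n./2 >= 2 n + 1]. *)
Lemma swap_factor (n : nat) : (4 <= n)%N ->
  2 * 2^-1 ^+ 6 ^+ n./2 * 2 ^+ n <= expR (- n%:R / 2) :> R.
Proof.
move=> n4; have [_ _ n6] := half_bounds n4.
apply: (@le_trans _ _ (2^-1 ^+ n)).
  rewrite -exprM !exprVn -mulrA mulrCA -exprS mulrC ler_pdivrMr ?exprn_gt0 //.
  by rewrite mulrC ler_pdivlMr ?exprn_gt0 // -exprD ler_eXn2l ?ltr1n.
have -> : - n%:R / 2 = - (1 / 2) * n%:R :> R by field.
rewrite -exp_pow; apply: lerXn2r; rewrite ?nnegrE ?expR_ge0 ?invr_ge0 //.
by apply: le_trans (expR_ge1Dx _); lra.
Qed.

(** The additive errors of [halasz_comparison] are at most [tau / 64] each, a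
    small part of [hX > tau]; moving them to the left costs a factor 2. *)
Lemma heavy_ratio (tau x1 x2 hX hY : R) :
    0 < tau <= 1 / 64 -> x1 <= tau * tau -> x2 <= tau * tau ->
    hX <= x1 + x2 + 2 ^- 7 * hY -> tau < hX ->
  64 * tau <= hY /\ hX <= 2^-1 ^+ 6 * hY.
Proof.
move=> /andP[tau0 tau1] h1 h2; have tt : tau * tau <= tau / 64 by nra.
have -> : 2 ^- 7 = 1 / 128 :> R by rewrite -natrX; field.
have -> : 2^-1 ^+ 6 = 1 / 64 :> R by rewrite exprVn -natrX; field.
by move=> h heavy; split; lra.
Qed.

(** The smallness condition of [Pr_independent_in] for the lazy law. *)
Lemma lazy_dependence (al kk N T tau : R) (n m : nat) :
    0 <= al <= 1 / 2 -> 1 <= kk -> N / 2 <= (n - m)%:R -> m%:R <= N ->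
    4 * T <= (4 * kk)^-1 * (al * N) -> expR (- (2 * T)) = tau * tau ->
    0 <= tau -> N * tau <= 1 / 64 ->
  m%:R * (1 - (4 * kk)^-1 * al) ^+ (n - m) <= 64 * tau / 2.
Proof.
move=> /andP[al0 al2] kk1 nm mN T4 two_tau tau0 Ntau.
have mu0 : 0 <= (4 * kk)^-1 by rewrite invr_ge0; lra.
have mukk : (4 * kk)^-1 * kk = 1 / 4 by field; rewrite gt_eqF //; lra.
move: (4 * kk)^-1 mu0 mukk T4 => mu mu0 mukk T4.
have mu1 : mu <= 1 / 4 by nra.
apply: (@le_trans _ _ (N * (tau * tau))); last first.
  by have := ler_wpM2r tau0 Ntau; lra.
have lin0 : 0 <= 1 - mu * al by nra.
apply: ler_pM => //; first exact: exprn_ge0.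
apply: (@le_trans _ _ (expR (- (mu * al)) ^+ (n - m))).
  by apply: lerXn2r; rewrite ?nnegrE ?expR_ge0 //; apply: expR_ge1Dx.
rewrite exp_pow -two_tau ler_expR.
by have := ler_wpM2l (mulr_ge0 mu0 al0) nm; lra.
Qed.

Lemma decay_scales (N T s : R) :
    4 <= N -> 8 * ln N <= T -> 16 * T <= N -> s = expR (- T / 2) ->
  [/\ 10 * expR (- T) <= s / 4, N * expR (- T) <= s / 4,
      expR (- N / 2) <= s / 4, N * expR (- T) <= 1 / 64
    & 0 < expR (- T) <= 1 / 64].
Proof.
move=> N4 TN NT sE.
have [Ns s256] := decay_bounds N4 TN; rewrite -sE in Ns s256.
have s0 : 0 < s by rewrite sE expR_gt0.
have tauE : expR (- T) = s * s by rewrite sE -expRD; congr expR; field.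
have Nss := ler_wpM2r (ltW s0) Ns.
have ss := ler_wpM2r (ltW s0) s256.
have L0 : 0 <= ln N by apply: ln_ge0; lra.
have NT2 : expR (- N / 2) <= expR (- T) by rewrite ler_expR; lra.
rewrite tauE in NT2 *; split; try lra.
by rewrite mulr_gt0 //=; lra.
Qed.

Section LargePrime.
Variables (n p : nat) (q : 'F_p -> R) (al : R).
Hypothesis p_prime : prime p.
Hypothesis n4 : (4 <= n)%N.
Hypothesis p_large : expR n%:R <= p%:R :> R.
Hypothesis q_dist : dist q.
Hypothesis q_atom : forall x, q x <= 1 - al.
Hypothesis al_half : 0 < al <= 1 / 2.
Hypothesis al_large : 8 * ln n%:R <= rate * al * n%:R.

Definition light_bound : R := expR (- (rate * al * n%:R)).

Definition heavy (W : 'M['F_p]_n) : bool :=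
  [&& (\rank W < n)%N, light_bound < hit q W
    & [forall t in perp W, (t != 0) ==> (n %/ 2304 < #|supp t|)%N]].

Definition lazy : 'F_p -> R := lazy_law q (4 * 22 ^+ 7)^-1.

Let al01 : 0 <= al <= 1 / 2.
Proof. by case/andP: al_half => /ltW ->. Qed.

Let N4 : 4 <= n%:R :> R.
Proof. by rewrite ler_nat. Qed.

Let k1 : 1 <= 22 ^+ 7 :> R.
Proof. by apply: exprn_ege1; rewrite ler1n. Qed.

Let d1 : 1 <= 2304%:R :> R.
Proof. by rewrite ler1n. Qed.

Let lnN0 : 0 <= ln n%:R :> R.
Proof. by apply: ln_ge0; apply: le_trans N4; rewrite ler1n. Qed.

Let T : R := rate * al * n%:R.

Let T0 : 0 <= T.
Proof. by apply: le_trans al_large; apply: mulr_ge0. Qed.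

Let scales : [/\ 48 * ln n%:R <= al * n%:R, T <= al * n%:R / 12,
    16 * T <= n%:R, al * (n%:R / 2304%:R) = 16 * 22 ^+ 7 * T
  & 4 * T <= (4 * 22 ^+ 7)^-1 * (al * n%:R)].
Proof. exact: (rate_scales al_half N4 d1 k1 lnN0 al_large erefl). Qed.

Let two_T : expR (- (2 * T)) = light_bound * light_bound.
Proof. by rewrite -expRD; congr expR; rewrite mulr_natl mulr2n opprD. Qed.

Let lazy_mass : 0 <= (4 * 22 ^+ 7 : R)^-1 <= 1.
Proof.
move: (22 ^+ 7 : R) k1 => kk kk1.
by rewrite invr_ge0 invf_le1; lra.
Qed.

(** Seven doublings gain [2^7], of which [2^6] survive the error terms. *)
Lemma heavy_gain (W : 'M['F_p]_n) : heavy W ->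
  64 * light_bound <= hit lazy W /\ hit q W <= 2^-1 ^+ 6 * hit lazy W.
Proof.
case/and3P => rkW heavyW /forall_inP dense.
have [e e_char] := @exists_character R p p_prime.
have comparison := halasz_comparison e_char q_dist 7 q_atom (proj1 (andP al01))
  (fun t tW t0 => implyP (dense t tW) t0).
have [_ _ NT aldd _] := scales.
have [_ _ _ _ tau01] := decay_scales N4 al_large NT erefl.
apply: heavy_ratio tau01 _ _ comparison heavyW; rewrite -two_T.
  rewrite expRN lef_pV2 ?posrE ?expR_gt0 //; last first.
    by rewrite ltr0n; apply: leq_trans (card_perp rkW); rewrite card_Fp // prime_gt0.
  apply: (@le_trans _ _ p%:R); last by rewrite ler_nat -{1}(card_Fp p_prime) card_perp.
  apply: le_trans p_large; rewrite ler_expR; apply: le_trans NT.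
  by move: T T0 => t t0; lra.
rewrite ler_expR mulNr lerN2.
have NK : n%:R / 2304%:R <= (n %/ 2304).+1%:R :> R.
  by rewrite ler_pdivrMr ?(lt_le_trans ltr01 d1) // -natrM ler_nat ltnW // ltn_ceil.
move: (22 ^+ 7 : R) k1 aldd => kk kk1 aldd.
rewrite ler_pdivlMr ?mulr_gt0 ?(lt_le_trans ltr01 kk1) //.
have -> : 2 * T * (8 * kk) = 16 * kk * T by ring.
by rewrite -aldd; apply: ler_wpM2l; first exact: (proj1 (andP al01)).
Qed.

Lemma Pr_heavy :
  Pr (prodw (prodw q)) [pred x : {ffun 'I_n -> {ffun 'I_n -> 'F_p}} |
    heavy <<rows x setT>>%MS] <= expR (- n%:R / 2).
Proof.
have [_ _ NT _ T4] := scales.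
have [_ _ _ Ntau tau01] := decay_scales N4 al_large NT erefl.
have [mn nm _] := half_bounds n4.
apply: le_trans (swap_factor n4).
apply: (Pr_heavy_span q_dist (lazy_dist q_dist lazy_mass)
  (h := 1 - (4 * 22 ^+ 7)^-1 * al)) => [t||| W hW].
- exact: lazy_atom.
- by rewrite lerBlDr lerDl mulr_ge0 ?(proj1 (andP al01)) ?(proj1 (andP lazy_mass)).
- by apply: exprn_ge0; rewrite invr_ge0.
- have [big gain] := heavy_gain hW; split=> //.
    by apply: lt_le_trans big; rewrite mulr_gt0 // expR_gt0.
  apply: (@le_trans _ _ (64 * light_bound / 2)); last by rewrite ler_pM2r.
  apply: (lazy_dependence al01 k1 _ _ T4 two_T) => //.
  + by rewrite ler_pdivrMr // -natrM ler_nat.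
  + by rewrite ler_nat.
  + exact: expR_ge0.
Qed.

(** A nonzero vector orthogonal to the row space is a kernel vector, so if no
    kernel vector is sparse the support condition of [heavy] holds. *)
Lemma singular_trichotomy (x : {ffun 'I_n -> {ffun 'I_n -> 'F_p}}) :
  (\rank (rows x setT) < n)%N ->
  [|| sparse_kernel (n %/ 2304) x,
      (\rank (rows x setT) < n)%N && (hit q (rows x setT) <= light_bound)
    | heavy <<rows x setT>>%MS].
Proof.
move=> rk; rewrite rk /=; case: (boolP (sparse_kernel _ x)) => //= nsp.
case: leP => //= hx.
have hitE : hit q <<rows x setT>>%MS = hit q (rows x setT).
  by apply: eq_Pr => z /=; rewrite genmxE.
rewrite /heavy mxrank_gen rk hitE hx /=; apply/forall_inP => t tp; apply/implyP => t0.
rewrite ltnNge; apply: contra nsp => st; apply/existsP; exists t; rewrite t0 st /=.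
apply/forallP => i; rewrite orthE; move: tp; rewrite inE => tp.
apply: submx_trans (rspan_sup (fun i => rv (x i)) (in_setT i)) _.
by apply/sub_kermxP/eqP; rewrite -submx0 -(eqmxMr _ (genmxE _)) submx0.
Qed.

Lemma Pr_singular_mod :
  Pr (prodw (prodw q)) [pred x : {ffun 'I_n -> {ffun 'I_n -> 'F_p}} |
    (\rank (rows x setT) < n)%N]
  <= expR (- T / 2).
Proof.
have rd := prodw_dist 'I_n q_dist; have rd2 := prodw_dist 'I_n rd.
have [alL alT12 NT _ _] := scales.
have [e10 eN en _ _] := decay_scales N4 al_large NT erefl.
have sparseP : Pr (prodw (prodw q)) (@sparse_kernel 'F_p n (n %/ 2304))
    <= expR (- T / 2) / 4.
  apply: le_trans (@Pr_sparse_kernel _ _ n q al _ q_dist q_atom al01) _.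
  apply: le_trans (sparse_sum n4 al_half alL) _.
  apply: le_trans e10; rewrite ler_wpM2l // ler_expR mulNr lerN2; exact: alT12.
have lightP := le_trans (Pr_light_span n q_dist (expR_ge0 _)) eN.
have heavyP := le_trans Pr_heavy en.
apply: le_trans (Pr_setU rd2 (A := [pred x | (\rank (rows x setT) < n)%N]) _) _.
  exact: singular_trichotomy.
apply: le_trans (lerD sparseP
  (le_trans (Pr_setU rd2 (fun _ h => h)) (lerD lightP heavyP))) _.
by move: (expR _) (expR_gt0 (- T / 2)) => s s0; lra.
Qed.

End LargePrime.
End Assembly.

(** * From integer matrices to residues *)

Local Open Scope classical_set_scope.

Section Transfer.
Context {R : realType}.

Lemma measurable_int_preimage {d : measure_display} {T : measurableType d}
    (P : probability T R) (X : {RV P >-> int}) (A : set int) :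
  measurable (X @^-1` A).
Proof.
have := @measurable_funP _ _ _ _ classical_sets.setT X measurableT A.
by rewrite classical_sets.setTI; apply.
Qed.

Lemma measure_finite_union {d : measure_display} {T : measurableType d}
    (P : probability T R) {J : finType} (Q : pred J) (B : J -> set T) (A : set T) :
    measurable A -> (forall j, measurable (B j)) ->
    (forall w, A w -> exists2 j, Q j & B j w) ->
  (P A <= \sum_(j | Q j) P (B j))%E.
Proof.
move=> mA mB AB; pose U := \big[classical_sets.setU/classical_sets.set0]_(j | Q j) B j.
have mU : measurable U by apply: bigsetU_measurable.
apply: (@le_trans _ _ (P U)).
  apply: le_measure; rewrite ?in_setE // => w /AB [j Qj Bj].
  by rewrite /U (bigD1 j) //=; left.
suff [] : measurable U /\ (P U <= \sum_(j | Q j) P (B j))%E by [].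
rewrite /U; elim/big_rec2: _ => [|j u V Qj [mV IH]]; first by rewrite measure0.
split; first exact: measurableU.
by apply: le_trans (measureU2 P (mB j) mV) _; apply: leeD2l.
Qed.

Lemma measure_finite_partition {d : measure_display} {T : measurableType d}
    (P : probability T R) {J : finType} (f : T -> J) :
    (forall j, measurable [set w | f w = j]) ->
  (\sum_j P [set w | f w = j] = 1)%E.
Proof.
move=> mf; rewrite (reindex (@enum_val J J)) /=; last exact/onW_bij/enum_val_bij.
pose F (i : 'I_#|J|) := [set w | f w = enum_val i].
rewrite -(@measure_bigsetU_ord _ _ _ P #|J| predT F) //.
- rewrite (_ : \big[_/_]_(i < _ | _) _ = classical_sets.setT); first exact: probability_setT.
  apply/seteqP; split=> // w _; rewrite (bigD1 (enum_rank (f w))) //=; left.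
  by rewrite /F /= enum_rankK.
- by move=> i; apply: mf.
- by move=> i j _ _ [w [/= fi fj]]; apply: enum_val_inj; rewrite -fi -fj.
Qed.

Section Residues.
Context {p : nat}.

Definition residue_class (x : 'F_p) : set int := [set z | z%:~R = x].

Definition residue_law {d : measure_display} {T : measurableType d}
    (P : probability T R) (xi : {RV P >-> int}) (x : 'F_p) : R :=
  fine (P (xi @^-1` residue_class x)).

Lemma residue_lawE {d : measure_display} {T : measurableType d}
    (P : probability T R) (xi : {RV P >-> int}) x :
  (residue_law xi x)%:E = P (xi @^-1` residue_class x).
Proof. by rewrite fineK // fin_num_measure //; apply: measurable_int_preimage. Qed.

Lemma residue_law_dist {d : measure_display} {T : measurableType d}
    (P : probability T R) (xi : {RV P >-> int}) : dist (residue_law xi).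
Proof.
split=> [x|]; first by rewrite /residue_law fine_ge0.
apply: EFin_inj; rewrite -sumEFin.
under eq_bigr do rewrite residue_lawE.
apply: (@measure_finite_partition _ _ P _ (fun w => (xi w)%:~R : 'F_p)) => x.
exact: (measurable_int_preimage xi (residue_class x)).
Qed.

Lemma residue_law_balanced {d : measure_display} {T : measurableType d}
    (P : probability T R) (xi : {RV P >-> int}) (alpha : R) x :
  prime p -> balanced alpha xi -> residue_law xi x <= 1 - alpha.
Proof.
move=> pp [_ /(_ p pp)] /bigmax_leP [_ /(_ x isT)].
by rewrite -residue_lawE lee_fin.
Qed.

End Residues.

(** The event is a countable union, over the integer matrices [A] with
    determinant zero, of the events that the random matrix equals [A]. *)
Lemma measurable_singular {d : measure_display} {T : measurableType d}
    (P : probability T R) (n : nat) (X : 'I_n * 'I_n -> {RV P >-> int}) :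
  measurable [set w | \det (random_matrix X w) = 0].
Proof.
pose fiber (A : 'M[int]_n) : set T :=
  \big[classical_sets.setI/classical_sets.setT]_(ij : 'I_n * 'I_n) (X ij @^-1` [set A ij.1 ij.2]).
have mfiber A : measurable (fiber A).
  by apply: bigsetI_measurable => ij _; apply: measurable_int_preimage.
have fiberP A w : fiber A w <-> random_matrix X w = A.
  rewrite /fiber; split.
    move=> h; apply/matrixP => i j; rewrite mxE; move: h.
    by rewrite (bigD1 (i, j)) //= => -[].
  move=> <-; elim/big_rec: _ => // -[i j] V _ IH; split => //=.
  by rewrite mxE.
pose F k := if unpickle k is Some A then
  (if \det (A : 'M[int]_n) == 0 then fiber A else classical_sets.set0) else classical_sets.set0.
rewrite (_ : [set w | _] = \bigcup_k F k).
  apply: bigcupT_measurable => k; rewrite /F.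
  by case: unpickle => // A; case: ifP.
apply/seteqP; split => [w /= dw|w [k _]].
  exists (pickle (random_matrix X w)) => //; rewrite /F pickleK dw eqxx.
  exact/fiberP.
rewrite /F; case: unpickle => // A; case: eqP => // dA /fiberP XA.
by rewrite /= XA.
Qed.

(** The determinant commutes with reduction modulo [p], and by independence the
    matrix of residues has the product law. *)
Lemma Pr_singular_transfer {d0 d : measure_display} {T0 : measurableType d0}
    {T : measurableType d} (P0 : probability T0 R) (P : probability T R)
    (xi : {RV P0 >-> int}) (n p : nat) (X : 'I_n * 'I_n -> {RV P >-> int}) :
    prime p -> iid_copies xi X ->
  (P [set w | (\det (random_matrix X w) = 0)%R] <=
   (Pr (prodw (prodw (residue_law (p := p) xi)))
     (fun x : {ffun 'I_n -> {ffun 'I_n -> 'F_p}} => (\rank (rows x finset.setT) < n)%N))%:E)%E.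
Proof.
move=> pp [ident indep].
pose B (x : {ffun 'I_n -> {ffun 'I_n -> 'F_p}}) : set T :=
  \bigcap_(ij in [set` [set: 'I_n * 'I_n]%SET]) X ij @^-1` residue_class (x ij.1 ij.2).
have PB x : P (B x) = (prodw (prodw (residue_law xi)) x)%:E.
  rewrite /B (indep [set: _]%SET (fun ij => residue_class (x ij.1 ij.2))) //.
  rewrite (eq_bigl predT) => [|ij]; last by rewrite inE.
  rewrite (eq_bigr (fun ij => (residue_law xi (x ij.1 ij.2))%:E)) => [|ij _]; last first.
    by rewrite residue_lawE; apply: (ident ij (residue_class (x ij.1 ij.2))).
  rewrite prodEFin; congr (_%:E); rewrite /prodw.
  by rewrite (pair_bigA _ (fun i j => residue_law xi (x i j))).
rewrite /Pr -sumEFin; under eq_bigr do rewrite -PB.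
apply: measure_finite_union => [|x|w /= dw]; first exact: measurable_singular.
  apply: fin_bigcap_measurable => [|ij _]; first exact: finite_finset.
  exact: measurable_int_preimage.
pose x : {ffun 'I_n -> {ffun 'I_n -> 'F_p}} := [ffun i => [ffun j => (X (i, j) w)%:~R]].
exists x; last by move=> [i j] _; rewrite /= !ffunE.
pose A : 'M['F_p]_n := map_mx intr (random_matrix X w).
have sA : (rows x finset.setT <= A)%MS.
  apply: rspan_sub => i _; rewrite (_ : rv (x i) = row i A) ?row_sub //.
  by apply/rowP => j; rewrite !mxE !ffunE.
apply: leq_ltn_trans (mxrankS sA) _; rewrite ltn_neqAle rank_leq_row andbT.
apply/negP => /eqP rk; have : A \in unitmx by rewrite -row_free_unit /row_free rk.
by rewrite unitmxE det_map_mx dw rmorph0 unitr0.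
Qed.

End Transfer.

Theorem theorem1p5 (R : realType) :
  exists c C0 : R, 0 < c /\ 0 < C0 /\
    exists n0 : nat, forall n : nat, (n0 <= n)%N ->
      forall (alpha : R)
        (d0 : measure_display) (T0 : measurableType d0) (P0 : probability T0 R)
        (xi : {RV P0 >-> int}),
      balanced alpha xi ->
      C0 * ln n%:R / n%:R <= alpha ->
      forall (d : measure_display) (T : measurableType d) (P : probability T R)
        (X : 'I_n * 'I_n -> {RV P >-> int}),
      iid_copies xi X ->
      (P [set w | (\det (random_matrix X w) = 0)%R]
         <= (expR (- (c * alpha * n%:R)))%:E)%E.
Proof.
have r0 := rate_gt0 R.
(* the bound modulo [p] has exponent [rate * (alpha / 2) * n / 2] *)
exists (rate R / 4), (16 / rate R); split; first exact: (divr_gt0 r0).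
split; first by apply: divr_gt0 r0.
exists 4%N => n n4 alpha d0 T0 P0 xi bal large d T P X iid.
have [/andP[a0 a1] _] := bal.
have n0 : 0 < n%:R :> R by rewrite ltr0n; apply: leq_trans n4.
have [p] := prime_above (Num.bound (expR n%:R : R)).
move=> bp pp; apply: le_trans (Pr_singular_transfer pp iid) _; rewrite lee_fin.
have pbig : expR n%:R <= p%:R :> R.
  apply: le_trans (ltW (archi_boundP (expR_ge0 _))) _.
  by rewrite ler_nat ltnW.
apply: le_trans (Pr_singular_mod (al := alpha / 2) pp n4 pbig _ _ _ _) _.
- exact: residue_law_dist.
- by move=> x; apply: le_trans (residue_law_balanced x pp bal) _; lra.
- by apply/andP; split; lra.
- move: large; rewrite ler_pdivrMr // mulrAC ler_pdivrMr //.
  move: (rate R) (ln _) => r l; lra.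
rewrite ler_expR; move: (rate R) => r; lra.
Qed.
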